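(* Let $K$ be a finite simplicial complex. Then $SC_n(K) = TC_n(|K|)$ for every integer $n \geq 2$.
   Context: **Higher topological complexity.** For a space $X$, let $I=[0,1]$ and let $PX = X^I$ be the free path space. For $n\ge 2$ let $e'_n : PX \to X^n$, $e'_n(\alpha) = (\alpha(0), \alpha(\tfrac{1}{n-1}), \alpha(\tfrac{2}{n-1}), \ldots, \alpha(1))$. $TC_n(X)$ is the Schwarz genus of $e'_n$: the least $r$ such that $X^n$ is a union of $r$ open subsets $U_1,\dots,U_r$ on each of which there is a continuous map $s_i: U_i\to PX$ with $e'_n\circ s_i = \mathrm{Id}_{U_i}$ (and $\infty$ if there is no such $r$). **Contiguity.** Simplicial maps $\phi,\phi' : K\to L$ are in the same contiguity class if there are a positive integer $c$ and simplicial maps $\phi=\phi_0,\phi_1,\dots,\phi_c=\phi' : K\to L$ such that $\phi_{i-1}(\sigma)\cup\phi_i(\sigma)$ is a simplex of $L$ for each simplex $\sigma$ of $K$ and each $i\in\{1,\dots,c\}$. **Products and subdivisions.** $|K|$ is the geometric realization of $K$. Fix a partial order on the vertices of $K$ that is total on each simplex. $K^n$ is the ordered product: its vertices are $n$-tuples of vertices of $K$, and a finite nonempty set of such tuples is a simplex if it is a chain for the coordinatewise order and each of its $n$ coordinate projections is a simplex of $K$. For finite $K$, $|K^n|$ is identified with $|K|^n$. $\mathrm{sd}$ is barycentric subdivision and $\mathrm{sd}^{k+1}=\mathrm{sd}\circ\mathrm{sd}^k$, $\mathrm{sd}^0$ the identity. For each $k \ge 1$ choose a simplicial approximation $\mathrm{sd}^k(K^n)\to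 \mathrm{sd}^{k-1}(K^n)$ of the identity; let $\iota^k_{K^n} : \mathrm{sd}^k(K^n)\to K^n$ be the iterated composition ($k\ge0$), and let $\pi_j : \mathrm{sd}^k(K^n)\to K$ be $\iota^k_{K^n}$ followed by the $j$-th projection $K^n\to K$, $j=1,\dots,n$. **Higher simplicial complexity.** $SC^k_n(K)$ is the smallest nonnegative integer $r$ such that there are subcomplexes $L_1,\dots,L_r$ covering $\mathrm{sd}^k(K^n)$ such that for each $i$ the restrictions $\pi_1,\dots,\pi_n : L_i\to K$ lie in the same contiguity class (and $\infty$ if there is no such $r$). This is independent of the chosen approximations. Finally $SC_n(K)=\min_{k\ge0} SC^k_n(K)$. *)

(* Defs.v *)
From HB Require Import structures.
From mathcomp Require Import all_boot.

Set Implicit Arguments.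
Unset Strict Implicit.
Unset Printing Implicit Defensive.

(* Finite abstract simplicial complexes; simplices are nonempty, and every
   element of [vertex] is a vertex. The empty complex is allowed. *)
Record scomplex := SComplex {
  vertex :> finType;
  simplices : {set {set vertex}};
  simplices0 : set0 \notin simplices;
  simplices1 : forall v, [set v] \in simplices;
  simplicesS : forall s t : {set vertex},
    s \in simplices -> t \subset s -> t != set0 -> t \in simplices
}.

Record smap (K L : scomplex) := SMap {
  smap_fun :> K -> L;
  smapP : forall s : {set K},
    s \in simplices K -> (smap_fun @: s) \in simplices L
}.

Lemma smap_id_subproof (K : scomplex) (s : {set K}) :
  s \in simplices K -> (idfun @: s) \in simplices K.
Proof. by rewrite imset_id. Qed.

Definition smap_id (K : scomplex) : smap K K := SMap (@smap_id_subproof K).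

Lemma smap_comp_subproof (K L M : scomplex) (g : smap L M) (f : smap K L)
  (s : {set K}) :
  s \in simplices K -> ((g \o f) @: s) \in simplices M.
Proof. by move=> sK; rewrite imset_comp; do 2!apply: smapP. Qed.

Definition smap_comp (K L M : scomplex) (g : smap L M) (f : smap K L) :
  smap K M := SMap (@smap_comp_subproof K L M g f).

Definition same_contiguity_class (K L : scomplex) (f g : smap K L) : Prop :=
  exists (c : nat) (phi : nat -> smap K L),
    [/\ (0 < c), phi 0 = f, phi c = g &
        forall i, (i < c) -> forall s : {set K}, s \in simplices K ->
          (phi i @: s :|: phi i.+1 @: s) \in simplices L].

Record subcomplex (K : scomplex) := Subcomplex {
  sub_simplices :> {set {set K}};
  sub_simplicesW : sub_simplices \subset simplices K;
  sub_simplicesS : forall s t : {set K},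
    s \in sub_simplices -> t \subset s -> t != set0 -> t \in sub_simplices
}.

Section SubcomplexAsComplex.
Variables (K : scomplex) (A : subcomplex K).

Definition sub_vertex : finType := {v : K | [set v] \in sub_simplices A}.

Definition sub_complex_simplices : {set {set sub_vertex}} :=
  [set s : {set sub_vertex} | (val @: s) \in sub_simplices A].

Lemma sub_complex_simplices0 : set0 \notin sub_complex_simplices.
Proof.
rewrite inE imset0; apply/negP => /(subsetP (sub_simplicesW A)).
exact/negP/simplices0.
Qed.

Lemma sub_complex_simplices1 v : [set v] \in sub_complex_simplices.
Proof. by rewrite inE imset_set1 (valP v). Qed.

Lemma sub_complex_simplicesS (s t : {set sub_vertex}) :
  s \in sub_complex_simplices -> t \subset s -> t != set0 ->
  t \in sub_complex_simplices.
Proof.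
rewrite !inE => sA ts t0; apply: sub_simplicesS sA _ _; first exact: imsetS.
by rewrite imset_eq0.
Qed.

Definition complex_of_sub : scomplex :=
  SComplex sub_complex_simplices0 sub_complex_simplices1 sub_complex_simplicesS.

Lemma smap_incl_subproof (s : {set complex_of_sub}) :
  s \in simplices complex_of_sub -> (val @: s) \in simplices K.
Proof. by rewrite inE; apply: (subsetP (sub_simplicesW A)). Qed.

Definition smap_incl : smap complex_of_sub K := SMap smap_incl_subproof.

Definition smap_restrict (L : scomplex) (f : smap K L) : smap complex_of_sub L :=
  smap_comp f smap_incl.

End SubcomplexAsComplex.

Record vertex_order (K : scomplex) := VertexOrder {
  vle :> rel K;
  vle_refl : reflexive vle;
  vle_anti : antisymmetric vle;
  vle_trans : transitive vle;
  vle_total : forall s : {set K},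
    s \in simplices K -> {in s &, forall u v, vle u v || vle v u}
}.

Section OrderedProduct.
Variables (K : scomplex) (le : vertex_order K) (n : nat).

Definition tuple_le (u v : {ffun 'I_n -> K}) : bool :=
  [forall j, le (u j) (v j)].

Definition oprod_simplices : {set {set {ffun 'I_n -> K}}} :=
  [set s : {set {ffun 'I_n -> K}} |
    [&& s != set0,
        [forall u in s, forall v in s, tuple_le u v || tuple_le v u] &
        [forall j, [set (u : {ffun 'I_n -> K}) j | u in s] \in simplices K]]].

Lemma oprod_simplices0 : set0 \notin oprod_simplices.
Proof. by rewrite inE eqxx. Qed.

Lemma oprod_simplices1 u : [set u] \in oprod_simplices.
Proof.
rewrite inE; apply/and3P; split.
- by apply/set0Pn; exists u; rewrite inE.
- apply/'forall_implyP => v /set1P ->; apply/'forall_implyP => w /set1P ->.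
  by rewrite orbb; apply/forallP => j; apply: vle_refl.
- by apply/forallP => j; rewrite imset_set1 simplices1.
Qed.

Lemma oprod_simplicesS (s t : {set {ffun 'I_n -> K}}) :
  s \in oprod_simplices -> t \subset s -> t != set0 -> t \in oprod_simplices.
Proof.
rewrite !inE => /and3P[_ /'forall_implyP sc /forallP sp] ts t0.
apply/and3P; split=> //.
- apply/'forall_implyP => u ut; apply/'forall_implyP => v vt.
  by have /'forall_implyP := sc u (subsetP ts u ut); apply; apply: (subsetP ts).
- apply/forallP => j; apply: simplicesS (sp j) _ _; first exact: imsetS.
  by rewrite imset_eq0.
Qed.

Definition oprod : scomplex :=
  SComplex oprod_simplices0 oprod_simplices1 oprod_simplicesS.

Lemma oproj_subproof (j : 'I_n) (s : {set oprod}) :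
  s \in simplices oprod ->
  [set (u : {ffun 'I_n -> K}) j | u in s] \in simplices K.
Proof. by rewrite inE => /and3P[_ _ /forallP]; apply. Qed.

Definition oproj (j : 'I_n) : smap oprod K := SMap (@oproj_subproof j).

End OrderedProduct.

Section Barycentric.
Variable K : scomplex.

Definition sd_vertex : finType := {s : {set K} | s \in simplices K}.

Definition sd_simplices : {set {set sd_vertex}} :=
  [set c : {set sd_vertex} | (c != set0) &&
    [forall s in c, forall t in c,
      (val s \subset val t) || (val t \subset val s)]].

Lemma sd_simplices0 : set0 \notin sd_simplices.
Proof. by rewrite inE eqxx. Qed.

Lemma sd_simplices1 s : [set s] \in sd_simplices.
Proof.
rewrite inE; apply/andP; split; first by apply/set0Pn; exists s; rewrite inE.
apply/'forall_implyP => v /set1P ->; apply/'forall_implyP => w /set1P ->.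
by rewrite subxx.
Qed.

Lemma sd_simplicesS (s t : {set sd_vertex}) :
  s \in sd_simplices -> t \subset s -> t != set0 -> t \in sd_simplices.
Proof.
rewrite !inE => /andP[_ /'forall_implyP sc] ts t0; rewrite t0 /=.
apply/'forall_implyP => u ut; apply/'forall_implyP => v vt.
by have /'forall_implyP := sc u (subsetP ts u ut); apply; apply: (subsetP ts).
Qed.

Definition sd : scomplex := SComplex sd_simplices0 sd_simplices1 sd_simplicesS.

End Barycentric.

Definition sd_iter (k : nat) (K : scomplex) : scomplex := iter k sd K.

From mathcomp Require Import all_order all_algebra.
From mathcomp Require Import all_classical all_reals all_analysis.

Import Order.TTheory GRing.Theory Num.Theory.
Import numFieldNormedType.Exports.

Local Open Scope classical_set_scope.
Local Open Scope ring_scope.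

Section Realization.
Variable R : realType.

Definition vsupport (K : scomplex) (x : K -> R) : {set K} :=
  [set v | x v != 0]%SET.

(* For finite K the topology of |K| is the one induced from R^K. *)
Definition realization_set (K : scomplex) :
    set (prod_topology (fun _ : K => R)) :=
  [set x | [/\ forall v, 0 <= x v, \sum_v x v = 1
             & vsupport x \in simplices K]].

Arguments realization_set : clear implicits.

Definition realization (K : scomplex) : topologicalType := realization_set K.

Definition bcoord (K : scomplex) (x : realization K) : K -> R := \val x.

Lemma bcoordP (K : scomplex) (x : realization K) :
  [/\ forall v, 0 <= bcoord x v, \sum_v bcoord x v = 1
    & vsupport (bcoord x) \in simplices K].
Proof. exact: set_mem (valP x). Qed.

Definition realize_coord (K L : scomplex) (f : smap K L) (x : realization K) :
    prod_topology (fun _ : L => R) :=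
  fun w => \sum_(v | f v == w) bcoord x v.

Lemma realize_coordP (K L : scomplex) (f : smap K L) (x : realization K) :
  realize_coord f x \in realization_set L.
Proof.
have [x0 x1 xK] := bcoordP x; apply/mem_set; split=> [w||].
- exact: sumr_ge0.
- by rewrite -x1 [RHS](partition_big f xpredT).
rewrite (_ : vsupport _ = (f @: vsupport (bcoord x))%SET); first exact: smapP.
apply/setP => w; rewrite inE psumr_neq0 //; apply/hasP/imsetP.
  case=> v _ /andP[/eqP <- xv]; exists v => //.
  by rewrite inE gt_eqF.
case=> v; rewrite inE => xv ->; exists v; first exact: mem_index_enum.
by rewrite eqxx lt_def xv x0.
Qed.

Definition realize (K L : scomplex) (f : smap K L) (x : realization K) :
  realization L := exist (fun y => y \in realization_set L) _ (realize_coordP f x).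

Definition sd_coord (K : scomplex) (x : realization (sd K)) :
    prod_topology (fun _ : K => R) :=
  fun v => \sum_(s : sd K | v \in val s) bcoord x s / #|val s|%:R.

Lemma sd_coordP (K : scomplex) (x : realization (sd K)) :
  sd_coord x \in realization_set K.
Proof.
have [x0 x1 xK] := bcoordP x.
have y0 v : 0 <= sd_coord x v.
  by apply: sumr_ge0 => s _; rewrite divr_ge0 ?x0 ?ler0n.
have y1 : \sum_v sd_coord x v = 1.
  rewrite -[RHS]x1 /sd_coord (exchange_big_dep xpredT) //=; apply: eq_bigr => s _.
  rewrite sumr_const -[LHS]mulr_natr divfK // pnatr_eq0 cards_eq0.
  by apply: contraNneq (simplices0 K) => <-; exact: (valP s).
apply/mem_set; split=> //.
have y2 : vsupport (sd_coord x) != finset.set0.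
  apply/eqP => y2; have yv v : sd_coord x v = 0.
    by move/setP/(_ v): y2; rewrite !inE => /negbFE/eqP.
  by move/eqP: y1; rewrite big1 // eq_sym oner_eq0.
move: xK; rewrite inE => /andP[/set0Pn[s0 s0x] /'forall_implyP xc].
have [s sx smax] := @arg_maxnP _ s0 (mem (vsupport (bcoord x)))
  (fun s : sd K => #|val s|) s0x.
apply: (simplicesS (valP s) _ y2); apply/fintype.subsetP => v.
rewrite inE psumr_neq0.
  case/hasP => t _ /andP[vt] /lt0r_neq0; rewrite mulf_eq0 negb_or => /andP[xt _].
  have tx : t \in vsupport (bcoord x) by rewrite inE.
  have /'forall_implyP/(_ t tx)/orP[st|ts] := xc s sx; last first.
    exact: (fintype.subsetP ts).
  suff -> : val s = val t by [].
  by apply/eqP; rewrite eqEcard st; exact: smax.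
by move=> t _; rewrite divr_ge0 ?x0 ?ler0n.
Qed.

(* The canonical homeomorphism |sd K| -> |K|: affine on simplices, it sends the
   vertex s of sd K to the barycenter of s. Under it |sd K| and |K| are
   identified, and it is the map meant by the identity in a simplicial
   approximation sd K -> K of the identity. *)
Definition sd_homeo (K : scomplex) (x : realization (sd K)) :
    realization K :=
  exist (fun y => y \in realization_set K) _ (sd_coordP x).

(* Whenever f x lies in the closed simplex |s|, so does |phi| x. *)
Definition simplicial_approximation (K L : scomplex)
    (f : realization K -> realization L) (phi : smap K L) : Prop :=
  forall (x : realization K) (s : {set L}), s \in simplices L ->
    vsupport (bcoord (f x)) \subset s ->
    vsupport (bcoord (realize phi x)) \subset s.

End Realization.

(* The minimum of a set of natural numbers, in the naturals extended by
   infinity; None stands for infinity, the minimum of the empty set. *)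
Definition least (P : nat -> Prop) : option nat :=
  if pselect (exists r, `[< P r >]) is left exP then Some (ex_minn exP)
  else None.

Section HigherTC.
Variable R : realType.

Definition unit_interval : topologicalType := `[0, 1]%classic : set R.

Lemma grid_point_proof (n : nat) (j : 'I_n) :
  (j%:R / n.-1%:R : R) \in (`[0, 1]%classic : set R).
Proof.
apply/mem_set; rewrite /= in_itv /= divr_ge0 ?ler0n //=.
case: n j => [[]//|[|n]] j /=; first by rewrite invr0 mulr0 ler01.
by rewrite ler_pdivrMr ?ltr0n // mul1r ler_nat -ltnS.
Qed.

Definition grid_point (n : nat) (j : 'I_n) : unit_interval :=
  exist (fun t => t \in (`[0, 1]%classic : set R)) _ (grid_point_proof j).

(* Free path space, with the compact-open topology. *)
Definition path_space (X : topologicalType) : Type :=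
  continuousType unit_interval X.

HB.instance Definition _ (X : topologicalType) :=
  Choice.on (path_space X).

HB.instance Definition _ (X : topologicalType) :=
  Topological.copy (path_space X)
    (@initial_topology (path_space X) {compact-open, unit_interval -> X}
       (fun alpha : continuousType unit_interval X =>
          alpha : unit_interval -> X)).

Definition path_eval (n : nat) (X : topologicalType) (alpha : path_space X) :
    prod_topology (fun _ : 'I_n => X) :=
  fun j => (alpha : continuousType unit_interval X) (grid_point j).

End HigherTC.

Definition genus_cover (E B : topologicalType) (p : E -> B) (r : nat) : Prop :=
  exists U : 'I_r -> set B,
    [/\ forall i, open (U i), \bigcup_i U i = setT &
        forall i, exists s : U i -> E,
          continuous s /\ forall b : U i, p (s b) = \val b].

Definition schwarz_genus (E B : topologicalType) (p : E -> B) : option nat :=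
  least (genus_cover p).

Definition TC (R : realType) (n : nat) (X : topologicalType) : option nat :=
  schwarz_genus (@path_eval R n X).

Section SimplicialComplexity.
Variables (K : scomplex) (le : vertex_order K) (n : nat).

(* sd_iter k.+1 L is by definition sd (sd_iter k L). *)
Definition approx_sequence : Type :=
  forall k : nat, smap (sd_iter k.+1 (oprod le n)) (sd_iter k (oprod le n)).

Variable appr : approx_sequence.

Fixpoint iota_map (k : nat) : smap (sd_iter k (oprod le n)) (oprod le n) :=
  match k with
  | 0%N => smap_id (oprod le n)
  | k'.+1 => smap_comp (iota_map k') (appr k')
  end.

Definition pi_map (k : nat) (j : 'I_n) : smap (sd_iter k (oprod le n)) K :=
  smap_comp (oproj le j) (iota_map k).

Definition SC_cover (k r : nat) : Prop :=
  exists A : 'I_r -> subcomplex (sd_iter k (oprod le n)),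
    (forall s, s \in simplices (sd_iter k (oprod le n)) ->
       exists i, s \in sub_simplices (A i)) /\
    (forall i j1 j2, same_contiguity_class
       (smap_restrict (A i) (pi_map k j1)) (smap_restrict (A i) (pi_map k j2))).

Definition SC_at (k : nat) : option nat := least (SC_cover k).

(* The minimum over k of SC_at k. *)
Definition SC : option nat := least (fun r => exists k, SC_at k = Some r).

End SimplicialComplexity.

(* Main.v *)
(* From contiguity to motion planners: the homeomorphisms |sd M| -> |M| and
   |K^n| -> |K|^n have continuous right inverses given by explicit formulas, in
   which the coordinates are lengths of intersections of intervals. If
   L is a subcomplex of M = sd^k K^n, the open star of |sd L| in |sd M| retracts onto
   |L| through straight lines; there each coordinate projection is homotopic to the
   realization of pi_j restricted to L, and contiguous maps are homotopic by straight
   lines, so all coordinates are homotopic. Concatenating these homotopies gives a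
   section of the path fibration.

   From motion planners to contiguity: take a Lebesgue number eta of the cover U_i of
   |K|^n, k large, and let L_i consist of the simplices of sd^k K^n all of whose points
   have their eta/2-ball in U_i. The planner H_i is uniformly continuous on such
   points, so for a fine subdivision t_l of the time segment, sending a vertex v to a
   vertex w of K with H_i(v, t_l)_w > 1/(#K + 1) defines simplicial maps phi_l. For a
   simplex s with barycenter b, phi_l(s) and phi_(l+1)(s) both lie in the support of
   H_i(b, t_(l+1)), and pi_j(s) lies in the support of b_j, which is H_i(b, t) at the
   j-th grid time t; hence pi_j1, phi_0, ..., phi_T, pi_j2 is a contiguity chain. *)

Require Import Defs.
From mathcomp Require Import all_boot all_order all_algebra.
From mathcomp Require Import all_classical all_reals all_analysis.
From mathcomp Require Import lra ring.

Set Implicit Arguments.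
Unset Strict Implicit.
Unset Printing Implicit Defensive.

Import Order.TTheory GRing.Theory Num.Theory.
Import numFieldNormedType.Exports.

Local Open Scope classical_set_scope.
Local Open Scope ring_scope.

(** * Topology of the realization *)

Lemma cvg_set_type (X : topologicalType) (A : set X) (S : Type)
    (F : set_system S) (f : S -> A) (x : A) :
  Filter F -> (fun s => \val (f s)) @ F --> \val x -> f @ F --> x.
Proof.
move=> FF fx U [_ [[V oV <-] /= Vx] VU]; rewrite nbhs_simpl /=.
have /fx : nbhs (\val x) V by apply: open_nbhs_nbhs.
by rewrite nbhs_simpl /=; apply: filterS => s; apply: VU.
Qed.

(** Allowing any filter lets this apply to the filter of balls in [realization_ball_sub]. *)
Lemma cvg_prod_topology (I : Type) (T : I -> topologicalType) (S : Type)
    (F : set_system S) (f : S -> prod_topology T) (x : prod_topology T) :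
  Filter F -> (forall i, f s i @[s --> F] --> x i) -> f @ F --> x.
Proof.
move=> FF fx; apply/cvg_sup => i U [_ [[V oV <-] /= Vx] VU].
have /fx : nbhs (x i) V by apply: open_nbhs_nbhs.
by rewrite !nbhs_simpl /=; apply: filterS => s; apply: VU.
Qed.

Lemma prod_coord_continuous (I : eqType) (T : I -> topologicalType) (i : I) :
  continuous (fun x : prod_topology T => x i).
Proof. exact: (@proj_continuous I T i). Qed.

Lemma set_val_continuous (X : topologicalType) (A : set X) :
  continuous (fun x : A => \val x : X).
Proof. exact: (@initial_continuous A X set_val). Qed.

Section RealizationTopology.
Variable R : realType.

Section RealFunctions.
Variables (Y : topologicalType) (f g : Y -> R).
Hypotheses (fc : continuous f) (gc : continuous g).

Lemma addr_continuous : continuous (fun y => f y + g y).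
Proof. by move=> y; apply: cvgD; [apply: fc | apply: gc]. Qed.

Lemma subr_continuous : continuous (fun y => f y - g y).
Proof. by move=> y; apply: cvgB; [apply: fc | apply: gc]. Qed.

Lemma mulr_continuous : continuous (fun y => f y * g y).
Proof. by move=> y; apply: cvgM; [apply: fc | apply: gc]. Qed.

Lemma maxr_continuous : continuous (fun y => Num.max (f y) (g y)).
Proof. by move=> y; apply: continuous_max; [apply: fc | apply: gc]. Qed.

Lemma minr_continuous : continuous (fun y => Num.min (f y) (g y)).
Proof. by move=> y; apply: continuous_min; [apply: fc | apply: gc]. Qed.

End RealFunctions.

Lemma bcoord_continuous (K : scomplex) (v : K) :
  continuous (fun x : realization R K => bcoord x v).
Proof.
move=> x.
exact: (@cvg_comp _ _ _ (fun x : realization R K => \val x)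
  (fun y : prod_topology (fun _ : K => R) => y v) _ _ _
  (@set_val_continuous _ (@realization_set R K) x)
  (@prod_coord_continuous K (fun=> R) v (\val x))).
Qed.

Lemma cvg_realization (K : scomplex) (S : Type) (F : set_system S)
    (f : S -> realization R K) (x : realization R K) :
  Filter F -> (forall v, bcoord (f s) v @[s --> F] --> bcoord x v) ->
  f @ F --> x.
Proof.
move=> FF fx; apply: cvg_set_type; apply: cvg_prod_topology => v.
exact: fx.
Qed.

Lemma continuous_realization (K : scomplex) (Y : topologicalType)
    (f : Y -> realization R K) :
  (forall v, continuous (fun y => bcoord (f y) v)) -> continuous f.
Proof. by move=> fc y; apply: cvg_realization => v; apply: fc. Qed.

Lemma realization_eq (K : scomplex) (x y : realization R K) :
  (forall v, bcoord x v = bcoord y v) -> x = y.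
Proof. by move=> xy; apply: val_inj; apply/funext. Qed.

Lemma sum_continuous (Y : topologicalType) (I : Type) (r : seq I) (P : pred I)
    (f : I -> Y -> R) :
  (forall i, continuous (f i)) -> continuous (fun y => \sum_(i <- r | P i) f i y).
Proof.
move=> fc y; elim: r => [|i r IH].
  by under eq_fun do rewrite big_nil; apply: cvg_cst.
under eq_fun do rewrite big_cons.
by case: (P i) => //; apply: cvgD => //; apply: fc.
Qed.

Lemma realize_continuous (K L : scomplex) (f : smap K L) :
  continuous (@realize R K L f).
Proof.
apply: continuous_realization => w.
apply: (@sum_continuous _ _ _ _ (fun v (x : realization R K) => bcoord x v)).
by move=> v; apply: bcoord_continuous.
Qed.

Lemma sd_homeo_continuous (K : scomplex) : continuous (@sd_homeo R K).
Proof.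
apply: continuous_realization => v; apply: (@sum_continuous _ _ _ _
  (fun (s : sd K) (x : realization R (sd K)) => bcoord x s / #|val s|%:R)).
by move=> s; apply: mulr_continuous; [apply: bcoord_continuous | apply: cst_continuous].
Qed.

(** Balls for the sup distance of barycentric coordinates. They replace a metric on the power: by
    the next two lemmas they form a neighbourhood base at each point. *)
Definition realization_ball (K : scomplex) (n : nat)
    (x : prod_topology (fun _ : 'I_n => realization R K)) (e : R) :
    set (prod_topology (fun _ : 'I_n => realization R K)) :=
  [set y | forall j v, `|bcoord (x j) v - bcoord (y j) v| < e].

(** Along the filter generated by the balls around x every coordinate converges to that of x. So the
    identity converges to x, and each neighbourhood of x belongs to that filter. *)
Lemma realization_ball_sub (K : scomplex) (n : nat)
    (x : prod_topology (fun _ : 'I_n => realization R K)) U :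
  nbhs x U -> exists2 e, 0 < e & realization_ball x e `<=` U.
Proof.
pose F := filter_from [set e : R | 0 < e] (realization_ball x).
have FF : Filter F.
  apply: filter_from_filter; first by exists 1 => /=.
  move=> i j i0 j0; exists (Num.min i j); first by rewrite /= lt_min i0 j0.
  by move=> y xy; split=> k v; have := xy k v; rewrite lt_min => /andP[].
have Fx : id @ F --> x.
  apply: (@cvg_prod_topology _ _ _ F id) => j; apply: (@cvg_realization K _ F) => v.
  apply/cvgrPdist_lt => e e0; exists e => // y; exact.
by move=> /Fx [e e0 eU]; exists e.
Qed.

Lemma nbhs_realization_ball (K : scomplex) (n : nat)
    (x : prod_topology (fun _ : 'I_n => realization R K)) e :
  0 < e -> nbhs x (realization_ball x e).
Proof.
move=> e0.
have FF : Filter (nbhs x) by apply: nbhs_filter.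
apply: (@filter_forall _ _ (fun (j : 'I_n) y => forall v,
  `|bcoord (x j) v - bcoord (y j) v| < e) (nbhs x)) => j.
apply: (@filter_forall _ _ (fun v y =>
  `|bcoord (x j) v - bcoord (y j) v| < e) (nbhs x)) => v.
have xv : bcoord (y j) v @[y --> x] --> bcoord (x j) v.
  exact: (@cvg_comp _ _ _ (fun y : prod_topology _ => y j) _ _ _ _
    (@prod_coord_continuous _ (fun=> realization R K) j x)
    (@bcoord_continuous K v (x j))).
by have /cvgrPdist_lt := xv; apply.
Qed.

End RealizationTopology.

(** * Continuity of finite extrema and lengths of interval partitions *)

Section Intervals.
Variable R : realType.

Lemma bigmax_continuous (Y : topologicalType) (I : Type) (r : seq I)
    (P : pred I) (c : R) (f : I -> Y -> R) :
  (forall i, continuous (f i)) ->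
  continuous (fun y => \big[Num.max/c]_(i <- r | P i) f i y).
Proof.
move=> fc; elim: r => [|i r IH].
  by under eq_fun do rewrite big_nil; apply: cst_continuous.
under eq_fun do rewrite big_cons; case: (P i) => //.
exact: maxr_continuous.
Qed.

Lemma bigmin_continuous (Y : topologicalType) (I : Type) (r : seq I)
    (P : pred I) (c : R) (f : I -> Y -> R) :
  (forall i, continuous (f i)) ->
  continuous (fun y => \big[Num.min/c]_(i <- r | P i) f i y).
Proof.
move=> fc; elim: r => [|i r IH].
  by under eq_fun do rewrite big_nil; apply: cst_continuous.
under eq_fun do rewrite big_cons; case: (P i) => //.
exact: minr_continuous.
Qed.

(** Additivity of Lebesgue measure: the intervals with [P u] are disjoint and fill [[a, b[]. The
    maximum with 0 gives empty intervals length 0. *)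
Lemma sum_interval_length (T : finType) (P : pred T) (A B : T -> R) (a b : R) :
  a <= b ->
  (forall u v t, A u <= t < B u -> A v <= t < B v -> u = v) ->
  (forall t, (a <= t < b) <-> (exists2 u, P u & A u <= t < B u)) ->
  \sum_(u | P u) Num.max 0 (B u - A u) = b - a.
Proof.
move=> ab dis cov.
pose F u : set R := [set` `[A u, B u[].
have muF (c d : R) : (@lebesgue_measure R [set` `[c, d[] =
    (Num.max 0 (d - c))%:E)%E.
  rewrite lebesgue_measure_itv /= lte_fin; case: ifPn => cd.
    by rewrite -EFinB max_r // subr_ge0 ltW.
  by rewrite max_l // subr_le0 leNgt.
apply: EFin_inj; rewrite -sumEFin -[in RHS](@max_r _ _ 0 (b - a)) ?subr_ge0 //.
rewrite -muF; under eq_bigr do rewrite -muF.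
rewrite -big_enum fsbig_seq ?enum_uniq //=.
rewrite -(@measure_fin_bigcup _ _ _ (@lebesgue_measure R)) //.
- congr (lebesgue_measure _); apply/seteqP; split=> t /=.
    case=> u /=; rewrite mem_enum => Pu; rewrite !in_itv /= => ut.
    by apply/cov; exists u.
  rewrite in_itv /= => /cov[u Pu ut]; exists u; first by rewrite /= mem_enum.
  by rewrite /= in_itv.
- move=> u v _ _ [t [/=]]; rewrite !in_itv /=; exact: dis.
Qed.

End Intervals.

(** * Continuous right inverses of |sd K| -> |K| and |K^n| -> |K|^n *)

Lemma vsupport_neq0 (R : realType) (K : scomplex) (q : K -> R) :
  \sum_v q v = 1 -> vsupport q != finset.set0.
Proof.
move=> q1; apply/eqP => q0; have qv v : q v = 0.
  by move/setP/(_ v): q0; rewrite !inE => /negbFE/eqP.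
by move/eqP: q1; rewrite big1 // eq_sym oner_eq0.
Qed.

(** * Barycentric subdivision through superlevel sets *)

Section BarycentricInverse.
Variables (R : realType) (K : scomplex).
Implicit Types (x : realization R K) (s : {set K}).

Lemma bcoord_ge0 x v : 0 <= bcoord x v.
Proof. by have [+ _ _] := bcoordP x. Qed.

Lemma bcoord_sum x : \sum_v bcoord x v = 1.
Proof. by have [_ + _] := bcoordP x. Qed.

Lemma bcoord_le1 x v : bcoord x v <= 1.
Proof.
rewrite -(bcoord_sum x) (bigD1 v) //= lerDl.
by apply: sumr_ge0 => w _; apply: bcoord_ge0.
Qed.

Lemma vsupport_simplex x : vsupport (bcoord x) \in simplices K.
Proof. by have [] := bcoordP x. Qed.

Lemma in_vsupport x v : (v \in vsupport (bcoord x)) = (0 < bcoord x v).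
Proof. by rewrite inE lt_def bcoord_ge0 andbT. Qed.

Lemma simplex_neq0 s : s \in simplices K -> s != finset.set0.
Proof. by apply: contraTneq => ->; apply: simplices0. Qed.

(** Layer-cake picture: for t in [[0, 1[], the superlevel set of x at t is s exactly when
    [lo x s <= t < hi x s]. The default values 0 and 1 confine this interval to [[0, 1[]. *)
Let lo x s := \big[Num.max/0]_(v | v \notin s) bcoord x v.
Let hi x s := \big[Num.min/1]_(v | v \in s) bcoord x v.
Let level x (t : R) := [set v | t < bcoord x v]%SET.

Let levelP x s t : reflect (0 <= t < 1 /\ s = level x t) (lo x s <= t < hi x s).
Proof.
apply: (iffP andP) => [[/bigmax_leP[t0 ts] /bigmin_gtP[t1 st]]|].
  split; first by rewrite t0 t1.
  apply/setP => v; rewrite inE; apply/idP/idP; first exact: st.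
  by apply: contraLR => /ts; rewrite leNgt.
case=> /andP[t0 t1 ->]; split.
  by apply/bigmax_leP; split=> // v; rewrite inE -leNgt.
by apply/bigmin_gtP; split=> // v; rewrite inE.
Qed.

(** The superlevel set at t contains v exactly for t in [[0, bcoord x v[], so the intervals of the
    simplices containing v partition that interval. *)
Lemma sum_level_length x v :
  \sum_(s : sd K | v \in val s) Num.max 0 (hi x (val s) - lo x (val s)) =
  bcoord x v.
Proof.
rewrite (@sum_interval_length _ _ _ _ _ 0 (bcoord x v)) ?bcoord_ge0 ?subr0 //.
  move=> s s' t /levelP[_ st] /levelP[_ s't].
  by apply: val_inj; rewrite st s't.
move=> t; split=> [/andP[t0 tx]|[s vs /levelP[/andP[t0 _] st]]]; last first.
  by rewrite t0; move: vs; rewrite st inE.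
have levK : level x t \in simplices K.
  apply: (simplicesS (vsupport_simplex x)).
    apply/fintype.subsetP => w; rewrite in_vsupport inE.
    exact: le_lt_trans.
  by apply/set0Pn; exists v; rewrite inE.
exists (exist (fun s => s \in simplices K) _ levK); first by rewrite inE.
by apply/levelP; rewrite t0 (lt_le_trans tx) ?bcoord_le1.
Qed.

(* With the coordinates of x sorted decreasingly, the barycenter of the first i
   vertices gets weight i (x_i - x_(i+1)). *)
Definition sd_inv_coord x : prod_topology (fun _ : sd K => R) :=
  fun s : sd K => #|val s|%:R * Num.max 0 (hi x (val s) - lo x (val s)).

Lemma sd_inv_coordE x (s : sd K) : sd_inv_coord x s / #|val s|%:R =
  Num.max 0 (hi x (val s) - lo x (val s)).
Proof.
rewrite /sd_inv_coord mulrC mulKf // pnatr_eq0 cards_eq0.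
exact: simplex_neq0 (valP s).
Qed.

Lemma sd_inv_coordP x : sd_inv_coord x \in @realization_set R (sd K).
Proof.
have y0 (s : sd K) : 0 <= sd_inv_coord x s by rewrite mulr_ge0 ?ler0n // le_max lexx.
have y1 : \sum_s sd_inv_coord x s = 1.
  rewrite -(bcoord_sum x).
  under [RHS]eq_bigr do rewrite -sum_level_length.
  rewrite (exchange_big_dep xpredT) //=; apply: eq_bigr => s _.
  by rewrite sumr_const /sd_inv_coord mulr_natl.
apply/mem_set; split=> //.
rewrite inE (vsupport_neq0 y1) /=.
(* A simplex of nonzero weight is a superlevel set, for instance at its own [lo]; superlevel sets
   are nested, hence form a chain. *)
have lev (s : sd K) : s \in vsupport (sd_inv_coord x) -> exists t, val s = level x t.
  rewrite inE mulf_eq0 negb_or => /andP[_ ys]; exists (lo x (val s)).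
  apply: (levelP _ _ _ _).2; rewrite lexx /= -subr_gt0.
  by move: ys; case: ltP => // _; rewrite eqxx.
apply/'forall_implyP => s /lev[t ->]; apply/'forall_implyP => s' /lev[t' ->].
by case: (leP t t') => tt'; apply/orP; [right|left];
  apply/fintype.subsetP => v; rewrite !inE => /(le_lt_trans _) -> //; exact: ltW.
Qed.

Definition sd_inv x : realization R (sd K) :=
  exist (fun y => y \in @realization_set R (sd K)) _ (sd_inv_coordP x).

Lemma sd_invK : cancel sd_inv (@sd_homeo R K).
Proof.
move=> x; apply: realization_eq => v; rewrite -[RHS]sum_level_length.
by apply: eq_bigr => s _; rewrite -sd_inv_coordE.
Qed.

Lemma sd_inv_continuous : continuous sd_inv.
Proof.
apply: continuous_realization => s.
apply: mulr_continuous; first exact: cst_continuous.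
apply: maxr_continuous; first exact: cst_continuous.
apply: subr_continuous; [apply: bigmin_continuous|apply: bigmax_continuous];
  by move=> v; apply: bcoord_continuous.
Qed.

End BarycentricInverse.

(** * The ordered product through common refinements of partitions of the unit interval *)

Section StaircaseInverse.
Variables (R : realType) (K : scomplex) (le : vertex_order K).
Implicit Types (x : realization R K).

(** Cut [[0, 1[] into consecutive intervals of lengths [bcoord x w], in increasing order of the
    vertices: [cell x v t] says that t lies in the one labelled v. The order need only be total on
    the support of x, as other vertices have length 0. *)
Let below x v := \sum_(w | le w v && (w != v)) bcoord x w.
Let upto x v := \sum_(w | le w v) bcoord x w.
Let cell x v t := below x v <= t < upto x v.

Let uptoE x v : upto x v = bcoord x v + below x v.
Proof. by rewrite /upto (bigD1 v) //= vle_refl. Qed.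

Let below_ge0 x v : 0 <= below x v.
Proof. by apply: sumr_ge0 => w _; apply: bcoord_ge0. Qed.

Let upto_le1 x v : upto x v <= 1.
Proof.
rewrite -(bcoord_sum x) [leRHS](bigID (le^~ v)) /= lerDl.
by apply: sumr_ge0 => w _; apply: bcoord_ge0.
Qed.

Let upto_le_below x v w : le w v -> w != v -> upto x w <= below x v.
Proof.
move=> wv neq; rewrite /below (bigID (le^~ w)) /=.
rewrite (eq_bigl (le^~ w)) => [|u].
  by rewrite lerDl; apply: sumr_ge0 => u _; apply: bcoord_ge0.
case uw: (le u w); rewrite ?andbF // andbT (vle_trans uw wv) /=.
by apply: contraNneq neq => uv; apply/eqP/(@vle_anti K le); rewrite wv -uv uw.
Qed.

Let cell_supp x v t : cell x v t -> v \in vsupport (bcoord x).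
Proof.
case/andP=> h /(le_lt_trans h); rewrite uptoE ltrDr => ?.
by rewrite in_vsupport.
Qed.

Let supp_total x v w : v \in vsupport (bcoord x) -> w \in vsupport (bcoord x) ->
  le v w || le w v.
Proof.
exact: (@vle_total K le _ (vsupport_simplex x) v w).
Qed.

(** If w were strictly below v, then [upto x w <= below x v <= s <= t < upto x w]. *)
Let cell_le x v w s t : cell x v s -> cell x w t -> s <= t -> le v w.
Proof.
move=> cv cw st; have := supp_total (cell_supp cv) (cell_supp cw).
case/orP=> // wv; have [->|neq] := eqVneq w v; first exact: vle_refl.
have := upto_le_below x wv neq.
move: cv cw => /andP[h _] /andP[_ h'] h''; exfalso; lra.
Qed.

Let cell_inj x v w t : cell x v t -> cell x w t -> v = w.
Proof.
move=> cv cw; apply: (@vle_anti K le).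
by rewrite (cell_le cv cw (lexx t)) (cell_le cw cv (lexx t)).
Qed.

(** On the support [upto x] is strictly increasing, so its maximiser on S is the greatest vertex of
    S. *)
Let top_vertex x (S : {set K}) : S != finset.set0 -> S \subset vsupport (bcoord x) ->
  exists2 v, v \in S & forall w, w \in S -> le w v.
Proof.
move=> /set0Pn[v0 v0S] /fintype.subsetP Sx.
case: (@arg_maxP _ _ _ v0 (mem S) (upto x) v0S) => v vS vmax.
exists v => // w wS; have /orP[//|vw] := supp_total (Sx _ wS) (Sx _ vS).
have [->|neq] := eqVneq v w; first exact: vle_refl.
have : upto x w <= upto x v := vmax w wS; have := upto_le_below x vw neq.
have := Sx _ wS; rewrite in_vsupport (uptoE x w) => h1 h2 h3; exfalso; lra.
Qed.

Let exists_cell x t : 0 <= t < 1 -> exists v, cell x v t.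
Proof.
case/andP=> t0 t1.
have [v1 v1x v1top] := top_vertex (simplex_neq0 (vsupport_simplex x)) (subxx _).
have tv1 : (v1 \in vsupport (bcoord x)) && (t < upto x v1).
  rewrite v1x /= (_ : upto x v1 = 1) // -(bcoord_sum x).
  rewrite [RHS](bigID (le^~ v1)) /= [X in _ + X]big1 ?addr0 // => w.
  by apply: contraNeq => xw; apply: v1top; rewrite inE.
pose P v := (v \in vsupport (bcoord x)) && (t < upto x v).
case: (@arg_minP _ _ _ v1 P (upto x) tv1) => v /andP[vx tv] vmin.
exists v; rewrite /cell tv andbT leNgt; apply/negP => tb.
(* If [t < below x v], some support vertex lies strictly below v, and the greatest such w satisfies
   [t < below x v <= upto x w]. Minimality of v then gives [upto x v <= below x v], against
   [0 < bcoord x v]. *)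
have Ssub : [set w in vsupport (bcoord x) | le w v && (w != v)]%SET
    \subset vsupport (bcoord x).
  by apply/fintype.subsetP => w; rewrite !inE => /andP[].
have [|w] := top_vertex _ Ssub.
  apply: contraTneq tb => S0; rewrite -leNgt /below big1 // => w wv.
  apply/eqP; apply: contraT => xw; have := finset.in_set0 w.
  by rewrite -S0 !inE xw wv.
rewrite inE => /andP[wx /andP[wv neq]] wtop.
have bw : below x v <= upto x w.
  rewrite /below /upto big_mkcond [leRHS]big_mkcond /=.
  apply: ler_sum => u _; case: ifP => [uv|_]; last first.
    by case: ifP => // _; apply: bcoord_ge0.
  case: ifP => // /negP uw; have [->//|xu] := eqVneq (bcoord x u) 0.
  by case: uw; apply: wtop; rewrite !inE xu uv.
have h : upto x v <= upto x w by apply: vmin; rewrite /P wx (lt_le_trans tb bw).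
have := upto_le_below x wv neq; have := uptoE x v.
move: vx; rewrite in_vsupport => h1 h2 h3; lra.
Qed.

Variable n : nat.
Local Notation rpow := (prod_topology (fun _ : 'I_n => realization R K)).
Implicit Types (z : rpow) (u : {ffun 'I_n -> K}).

(** The ends of the intersection of the n cells labelled [u j] in [z j]. The default values keep it
    inside [[0, 1[] even for n = 0. *)
Let left_end z u := \big[Num.max/0]_j below (z j) (u j).
Let right_end z u := \big[Num.min/1]_j upto (z j) (u j).

Let stairP z u t : reflect (0 <= t < 1 /\ forall j, cell (z j) (u j) t)
  (left_end z u <= t < right_end z u).
Proof.
apply: (iffP andP) => [[/bigmax_leP[t0 tl] /bigmin_gtP[t1 tr]]|].
  by rewrite t0 t1; split=> // j; rewrite /cell tl ?tr.
case=> /andP[t0 t1] tu; split.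
  by apply/bigmax_leP; split=> // j _; have /andP[] := tu j.
by apply/bigmin_gtP; split=> // j _; have /andP[] := tu j.
Qed.

Let stair_inj z u v t : left_end z u <= t < right_end z u ->
  left_end z v <= t < right_end z v -> u = v.
Proof.
by move=> /stairP[_ ut] /stairP[_ vt]; apply/ffunP => j; apply: cell_inj (ut j) (vt j).
Qed.

Let exists_stair z t : 0 <= t < 1 -> exists u, left_end z u <= t < right_end z u.
Proof.
move=> t01; have /choice[f ft] : forall j, exists v, cell (z j) v t.
  by move=> j; apply: exists_cell.
by exists (finfun f); apply/stairP; split=> // j; rewrite ffunE.
Qed.

(* Read the barycentric coordinates of z j as the lengths of consecutive
   subintervals of [0, 1[ labelled by the vertices in increasing order; the tuple u
   gets the length of the set of points labelled u j in z j for all j. *)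
Definition oprod_inv_coord z : prod_topology (fun _ : oprod le n => R) :=
  fun u : oprod le n => Num.max 0 (right_end z u - left_end z u).

(** The intervals of the tuples with j-th entry v partition the cell of v in [z j]. *)
Lemma sum_oprod_inv_coord z j v :
  \sum_(u : oprod le n | oproj le j u == v) oprod_inv_coord z u = bcoord (z j) v.
Proof.
rewrite -[RHS](addrK (below (z j) v)) -uptoE.
apply: sum_interval_length.
- by rewrite uptoE lerDr bcoord_ge0.
- by move=> u u' t; apply: stair_inj.
- move=> t; split=> [tv|[u /eqP <-] /stairP[_]]; last exact.
  have [|u ut] := @exists_stair z t.
    have := below_ge0 (z j) v; have := upto_le1 (z j) v.
    by move: tv => /andP[h1 h2] h3 h4; apply/andP; split; lra.
  exists u => //; apply/eqP; move/stairP: ut => [_ /(_ j)].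
  by move/cell_inj; apply.
Qed.

(** As t grows, all n labels increase together, so the tuples with a nonempty interval form a chain;
    their j-th entries lie in the support of [z j]. *)
Lemma oprod_inv_coordP z : oprod_inv_coord z \in @realization_set R (oprod le n).
Proof.
have y0 u : 0 <= oprod_inv_coord z u by rewrite le_max lexx.
have y1 : \sum_(u : oprod le n) oprod_inv_coord z u = 1.
  rewrite -[RHS]subr0; apply: sum_interval_length => //.
    by move=> u v t; apply: stair_inj.
  move=> t; split=> [t01|[u _ /stairP[]]//].
  by have [u ut] := exists_stair z t01; exists u.
have ne := vsupport_neq0 y1.
have stair u : u \in vsupport (oprod_inv_coord z) ->
    exists t, forall j, cell (z j) (u j) t.
  rewrite inE => yu; exists (left_end z u).
  suff /stairP[] : left_end z u <= left_end z u < right_end z u by [].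
  rewrite lexx /= -subr_gt0.
  by move: yu; rewrite /oprod_inv_coord; case: ltP => // _; rewrite eqxx.
apply/mem_set; split=> //; rewrite inE ne /=; apply/andP; split.
  apply/'forall_implyP => u /stair[s us]; apply/'forall_implyP => v /stair[t vt].
  case: (leP s t) => st; apply/orP; [left|right]; apply/forallP => j.
    exact: cell_le (us j) (vt j) st.
  exact: cell_le (vt j) (us j) (ltW st).
apply/forallP => j; apply: (@simplicesS K _ _ (vsupport_simplex (z j))).
  by apply/fintype.subsetP => _ /finset.imsetP[u /stair[t ut] ->]; apply: cell_supp (ut j).
by rewrite imset_eq0.
Qed.

Definition oprod_inv z : realization R (oprod le n) :=
  exist (fun y => y \in @realization_set R (oprod le n)) _ (oprod_inv_coordP z).

Lemma oprod_invK z j : realize (oproj le j) (oprod_inv z) = z j.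
Proof. by apply: realization_eq => v; apply: sum_oprod_inv_coord. Qed.

Lemma oprod_inv_continuous : continuous oprod_inv.
Proof.
apply: continuous_realization => u.
have zc j v : continuous (fun z : rpow => bcoord (z j) v).
  move=> z; exact: (@cvg_comp _ _ _ (fun y : rpow => y j) _ _ _ _
    (@prod_coord_continuous _ (fun=> realization R K) j z)
    (@bcoord_continuous R K v (z j))).
apply: maxr_continuous; first exact: cst_continuous.
by apply: subr_continuous; [apply: bigmin_continuous|apply: bigmax_continuous];
  move=> j; apply: sum_continuous.
Qed.

End StaircaseInverse.

(** * Homotopies *)

Section Homotopy.
Variable R : realType.

Section Glue.
Variables X Y : topologicalType.

Lemma glue_continuous (H1 H2 : X * R -> Y) (c : R) :
  continuous H1 -> continuous H2 -> (forall x, H1 (x, c) = H2 (x, c)) ->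
  continuous (fun p => if p.2 <= c then H1 p else H2 p).
Proof.
move=> cH1 cH2 H12 p U nU.
change (\forall q \near p, U (if q.2 <= c then H1 q else H2 q)).
move: nU => /=.
have c2 : (fun q : X * R => q.2) @ p --> p.2 by apply: cvg_snd.
case: (ltgtP p.2 c) => pc nU.
- have h1 : \forall q \near p, U (H1 q) by apply: cH1.
  have h2 : \forall q \near p, q.2 < c by apply: (c2 [set t | t < c]); apply: lt_nbhsl.
  by near=> q; rewrite ifT; [near: q | apply: ltW; near: q].
- have h1 : \forall q \near p, U (H2 q) by apply: cH2.
  have h2 : \forall q \near p, c < q.2 by apply: (c2 [set t | c < t]); apply: lt_nbhsr.
  near=> q; rewrite ifF; first by near: q.
  by apply/negbTE; rewrite -ltNge; near: q.
- have h1 : \forall q \near p, U (H1 q) by apply: cH1.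
  have h2 : \forall q \near p, U (H2 q).
    by apply: cH2; case: p pc nU {c2 h1} => x t /= ->; rewrite H12.
  by near=> q; case: ifP => _; near: q.
Unshelve. all: by end_near. Qed.

Lemma reparam_continuous (Z : topologicalType) (H : X * R -> Y) (f : Z -> X)
    (r : Z -> R) :
  continuous H -> continuous f -> continuous r ->
  continuous (fun z => H (f z, r z)).
Proof.
move=> cH cf cr z.
apply: (@cvg_comp _ _ _ (fun z => (f z, r z)) H _ (nbhs (f z, r z))); last exact: cH.
exact: (cvg_pair (cf z) (cr z)).
Qed.

(* The time parameter ranges over all of R, so that reparametrizations need no
   bounds; only the times in [0, 1] matter. *)
Definition homotopic (f g : X -> Y) := exists H : X * R -> Y,
  [/\ continuous H, forall x, H (x, 0) = f x & forall x, H (x, 1) = g x].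

Lemma fst_continuous : continuous (fun p : X * R => p.1).
Proof. by move=> p; apply: cvg_fst. Qed.

Lemma snd_continuous : continuous (fun p : X * R => p.2).
Proof. by move=> p; apply: cvg_snd. Qed.

Lemma homotopic_refl (f : X -> Y) : continuous f -> homotopic f f.
Proof.
move=> cf; exists (fun p => f p.1); split=> // p.
exact: (@cvg_comp _ _ _ _ f _ _ _ (@fst_continuous p) (cf p.1)).
Qed.

Lemma homotopic_sym (f g : X -> Y) : homotopic f g -> homotopic g f.
Proof.
move=> [H [cH H0 H1]]; exists (fun p => H (p.1, 1 - p.2)); split.
- apply: reparam_continuous => //; first exact: fst_continuous.
  by apply: subr_continuous; [apply: cst_continuous | apply: snd_continuous].
- by move=> x; rewrite subr0.
- by move=> x; rewrite subrr.
Qed.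

(** The homotopies are laid end to end on successive unit intervals, without rescaling, so that
    [g j] is met exactly at time j. This is what a path through prescribed grid points requires. *)
Lemma homotopic_chain (g : nat -> X -> Y) (m : nat) :
  continuous (g 0%N) -> (forall j, (j < m)%N -> homotopic (g j) (g j.+1)) ->
  exists2 G : X * R -> Y, continuous G &
    forall j x, (j <= m)%N -> G (x, j%:R) = g j x.
Proof.
move=> cg; elim: m => [|m IH] gg.
  have [G [cG G0 _]] := homotopic_refl cg; exists G => // j x.
  by rewrite leqn0 => /eqP ->.
have [j jm|G cG GE] := IH; first by apply: gg; rewrite ltnS ltnW.
have [H [cH H0 H1]] := gg m (ltnSn m).
exists (fun p => if p.2 <= m%:R then G p else H (p.1, p.2 - m%:R)).
  apply: glue_continuous => // [|x]; last by rewrite subrr H0 GE.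
  apply: reparam_continuous => //; first exact: fst_continuous.
  by apply: subr_continuous; [apply: snd_continuous | apply: cst_continuous].
move=> j x jm /=; rewrite ler_nat; case: ifP => [|jm']; first exact: GE.
have -> : j = m.+1 by apply/eqP; rewrite eqn_leq jm ltnNge jm'.
by rewrite -natr1 addrAC subrr add0r H1.
Qed.

Lemma homotopic_trans (f g h : X -> Y) : continuous f ->
  homotopic f g -> homotopic g h -> homotopic f h.
Proof.
move=> cf fg gh.
have [|[|[|]]//|G cG GE] :=
  @homotopic_chain (fun j => if j is j'.+1 then (if j' is 0%N then g else h) else f) 2.
  by [].
exists (fun p => G (p.1, 2 * p.2)); split.
- apply: reparam_continuous => //; first exact: fst_continuous.
  by apply: mulr_continuous; [apply: cst_continuous | apply: snd_continuous].
- by move=> x; rewrite mulr0 (GE 0%N).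
- by move=> x; rewrite mulr1 (GE 2%N).
Qed.

End Glue.

Lemma homotopic_compl (X Y Z : topologicalType) (f g : X -> Y) (k : Y -> Z) :
  continuous k -> homotopic f g -> homotopic (k \o f) (k \o g).
Proof.
move=> ck [H [cH H0 H1]]; exists (k \o H); split=> [p|x|x] /=.
- exact: (@cvg_comp _ _ _ H k _ _ _ (cH p) (ck (H p))).
- by rewrite H0.
- by rewrite H1.
Qed.

Lemma homotopic_compr (X Y Z : topologicalType) (f g : Y -> Z) (k : X -> Y) :
  continuous k -> homotopic f g -> homotopic (f \o k) (g \o k).
Proof.
move=> ck [H [cH H0 H1]]; exists (fun p => H (k p.1, p.2)); split=> //.
apply: reparam_continuous => //; last exact: snd_continuous.
move=> p; exact: (@cvg_comp _ _ _ _ k _ _ _ (@fst_continuous _ p) (ck p.1)).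
Qed.

Lemma segment_point (K : scomplex) (x y : realization R K) (t : R) :
  0 <= t <= 1 ->
  (exists2 s, s \in simplices K &
     vsupport (bcoord x) :|: vsupport (bcoord y) \subset s)%SET ->
  exists z : realization R K,
    forall v, bcoord z v = (1 - t) * bcoord x v + t * bcoord y v.
Proof.
move=> /andP[t0 t1] [s sK xys].
pose q : prod_topology (fun _ : K => R) :=
  fun v => (1 - t) * bcoord x v + t * bcoord y v.
suff qP : q \in @realization_set R K.
  by exists (exist (fun q => q \in @realization_set R K) q qP).
have q1 : \sum_v q v = 1.
  by rewrite big_split /= -!mulr_sumr !bcoord_sum !mulr1 subrK.
apply/mem_set; split=> // [v|].
  by rewrite addr_ge0 // mulr_ge0 ?subr_ge0 // bcoord_ge0.
apply: (simplicesS sK).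
  apply: fintype.subset_trans xys; apply/fintype.subsetP => v; rewrite !inE.
  apply: contraNT; rewrite negb_or !negbK /q => /andP[/eqP -> /eqP ->].
  by rewrite !mulr0 addr0.
exact: vsupport_neq0 q1.
Qed.

Lemma homotopic_simplex (X : topologicalType) (K : scomplex)
    (f g : X -> realization R K) :
  continuous f -> continuous g ->
  (forall x, exists2 s, s \in simplices K &
     vsupport (bcoord (f x)) :|: vsupport (bcoord (g x)) \subset s)%SET ->
  homotopic f g.
Proof.
move=> cf cg fg.
(* Time runs over all of R, but the straight line stays in the realization only for times in [0, 1];
   hence the clamping. *)
pose c (t : R) : R := Num.max 0 (Num.min 1 t).
have c01 t : 0 <= c t <= 1.
  by rewrite /c le_max lexx /= ge_max ler01 ge_min lexx.
have /choice[H HE] : forall p : X * R, exists z : realization R K,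
    forall v, bcoord z v =
      (1 - c p.2) * bcoord (f p.1) v + c p.2 * bcoord (g p.1) v.
  by move=> p; apply: segment_point.
have fst_coord (h : X -> realization R K) v : continuous h ->
    continuous (fun p : X * R => bcoord (h p.1) v).
  move=> ch p; apply: (@cvg_comp _ _ _ (fun p : X * R => h p.1) (fun y => bcoord y v)
     _ (nbhs (h p.1))); last exact: bcoord_continuous.
  exact: (@cvg_comp _ _ _ _ h _ _ _ (@fst_continuous _ p) (ch p.1)).
have cc : continuous (fun p : X * R => c p.2).
  apply: maxr_continuous; first exact: cst_continuous.
  by apply: minr_continuous; [apply: cst_continuous | apply: snd_continuous].
exists H; split=> [|x|x].
- apply: continuous_realization => v; under eq_fun do rewrite HE.
  apply: addr_continuous; apply: mulr_continuous; try exact: fst_coord; last by [].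
  by apply: subr_continuous; first exact: cst_continuous.
- apply: realization_eq => v; rewrite HE /= /c (min_idPr _) ?ler01 // maxxx.
  by rewrite subr0 mul1r mul0r addr0.
- apply: realization_eq => v; rewrite HE /= /c minxx (max_idPr _) ?ler01 //.
  by rewrite subrr mul0r mul1r add0r.
Qed.

End Homotopy.

Section PathSections.
Variable R : realType.

Lemma section_of_homotopic (X : topologicalType) (n : nat)
    (U : set (prod_topology (fun _ : 'I_n => X))) :
  (1 < n)%N ->
  (forall j k : 'I_n,
     homotopic R (fun b : U => \val b j) (fun b : U => \val b k)) ->
  exists s : U -> path_space R X,
    continuous s /\ forall b, @path_eval R n X (s b) = \val b.
Proof.
case: n U => [//|n] U n0 UU.
have cU (j : 'I_n.+1) : continuous (fun b : U => \val b j).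
  move=> b; exact: (@cvg_comp _ _ _ (fun b : U => \val b) (fun z => z j) _ _ _
    (@set_val_continuous _ U b)
    (@prod_coord_continuous _ (fun=> X) j (\val b))).
(* There are now n + 1 coordinates, joined by n homotopies. The grid point of index j is j / n,
   which the factor [n%:R] below sends to time j. *)
have [||G cG GE] := @homotopic_chain R U X (fun m b => \val b (inord m)) n.
- exact: cU.
- by move=> j _; apply: UU.
have cval : continuous (fun t : unit_interval R => \val t : R).
  exact: set_val_continuous.
pose F (p : U * unit_interval R) := G (p.1, n%:R * \val p.2).
have cF : continuous F.
  apply: reparam_continuous => //; first by move=> p; apply: cvg_fst.
  apply: mulr_continuous; first exact: cst_continuous.
  move=> p; exact: (@cvg_comp _ _ _ (fun p : U * unit_interval R => p.2) _ _ _ _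
    cvg_snd (cval p.2)).
(* Currying gives both the continuity of each path and that of the map into the compact-open
   topology. *)
have [cF1 cF2] := continuous_curry cF.
exists (fun b => mkcts (cF2 b) : path_space R X); split.
  by apply: continuous_comp_initial.
move=> b; apply/funext => j; rewrite /path_eval /= /mkcts /curry /F /=.
rewrite mulrC divfK; last by rewrite pnatr_eq0 -lt0n.
by rewrite GE ?inord_val // -ltnS.
Qed.

End PathSections.

(** * From contiguity to motion planners *)

Section SimplicialMaps.
Variable R : realType.

Lemma vsupport_realize (K L : scomplex) (f : smap K L) (x : realization R K) :
  vsupport (bcoord (realize f x)) = (f @: vsupport (bcoord x))%SET.
Proof.
apply/setP => w; rewrite inE psumr_neq0; last by move=> v _; apply: bcoord_ge0.
apply/hasP/finset.imsetP => [[v _ /andP[/eqP <- xv]]|[v xv ->]].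
  by exists v => //; rewrite in_vsupport.
by exists v; [apply: mem_index_enum | rewrite eqxx -in_vsupport].
Qed.

Lemma realize_comp (K L M : scomplex) (g : smap L M) (f : smap K L)
    (x : realization R K) : realize (smap_comp g f) x = realize g (realize f x).
Proof.
apply: realization_eq => w.
rewrite [LHS](partition_big f (fun v => g v == w)) //=.
apply: eq_bigr => u /eqP gu; apply: eq_bigl => v /=.
by case: (eqVneq (f v) u) => [->|]; rewrite ?andbF // gu eqxx.
Qed.

Lemma realize_id (K : scomplex) (x : realization R K) : realize (smap_id K) x = x.
Proof. by apply: realization_eq => v; rewrite /bcoord /= /realize_coord big_pred1_eq. Qed.

(** The support of [realize psi x] lies in that of [g x], so its image under phi lies in the support
    of [realize phi (g x)], to which the hypothesis on f applies. *)
Lemma simplicial_approximation_comp (K L M : scomplex)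
    (f : realization R L -> realization R M) (phi : smap L M)
    (g : realization R K -> realization R L) (psi : smap K L) :
  simplicial_approximation f phi -> simplicial_approximation g psi ->
  simplicial_approximation (f \o g) (smap_comp phi psi).
Proof.
move=> fphi gpsi x s sM fgx; rewrite realize_comp (vsupport_realize phi).
apply: fintype.subset_trans (fphi _ _ sM fgx); rewrite (vsupport_realize phi).
apply: finset.imsetS; apply: gpsi => //; apply: vsupport_simplex.
Qed.

Lemma simplicial_approximation_homotopic (K L : scomplex)
    (f : realization R K -> realization R L) (phi : smap K L) :
  continuous f -> simplicial_approximation f phi ->
  homotopic R (realize phi) f.
Proof.
move=> cf fphi; apply: homotopic_simplex => // [|x]; first exact: realize_continuous.
exists (vsupport (bcoord (f x))); first exact: vsupport_simplex.
by rewrite finset.subUset subxx andbT; apply: fphi; first exact: vsupport_simplex.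
Qed.

Lemma contiguous_homotopic (K L : scomplex) (f g : smap K L) :
  same_contiguity_class f g -> homotopic R (@realize R K L f) (@realize R K L g).
Proof.
move=> [c [phi [_ <- <- phiP]]]; elim: c phiP => [|c IH] phiP.
  exact/homotopic_refl/realize_continuous.
apply: (@homotopic_trans _ _ _ _ (realize (phi c))); first exact: realize_continuous.
  by apply: IH => i ic; apply: phiP; rewrite ltnW.
apply: homotopic_simplex => [||x]; try exact: realize_continuous.
exists (phi c @: vsupport (bcoord x) :|: phi c.+1 @: vsupport (bcoord x))%SET.
  by apply: phiP => //; apply: vsupport_simplex.
by rewrite !vsupport_realize subxx.
Qed.

(** The largest simplex of the flag supporting y contains all the others. *)
Lemma vsupport_sd_homeo (K : scomplex) (y : realization R (sd K)) :
  exists2 s, s \in vsupport (bcoord y) &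
    vsupport (bcoord (sd_homeo y)) \subset val s.
Proof.
have := vsupport_simplex y; rewrite inE => /andP[/set0Pn[s0 s0y] /'forall_implyP yc].
have [s sy smax] := @arg_maxnP _ s0 (mem (vsupport (bcoord y)))
  (fun s : sd K => #|val s|) s0y.
exists s => //; apply/fintype.subsetP => v; rewrite inE.
rewrite psumr_neq0; last by move=> t _; rewrite divr_ge0 ?bcoord_ge0.
case/hasP => t _ /andP[vt] /lt0r_neq0; rewrite mulf_eq0 negb_or => /andP[yt _].
have ty : t \in vsupport (bcoord y) by rewrite inE.
have /'forall_implyP/(_ t ty)/orP[st|ts] := yc s sy; last first.
  exact: (fintype.subsetP ts).
suff -> : val s = val t by [].
by apply/eqP; rewrite eqEcard st; exact: smax.
Qed.

Fixpoint sd_homeo_iter (N : scomplex) (k : nat) :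
    realization R (sd_iter k N) -> realization R N :=
  match k with
  | 0%N => id
  | k'.+1 => fun x => sd_homeo_iter (@sd_homeo R (sd_iter k' N) x)
  end.

Fixpoint sd_inv_iter (N : scomplex) (k : nat) (x : realization R N) :
    realization R (sd_iter k N) :=
  match k with
  | 0%N => x
  | k'.+1 => @sd_inv R (sd_iter k' N) (sd_inv_iter k' x)
  end.

Lemma sd_inv_iterK (N : scomplex) (k : nat) :
  cancel (@sd_inv_iter N k) (@sd_homeo_iter N k).
Proof. by elim: k => [|k IH] x //=; rewrite sd_invK IH. Qed.

Lemma sd_homeo_iter_continuous (N : scomplex) (k : nat) :
  continuous (@sd_homeo_iter N k).
Proof.
elim: k => [|k IH] x; first exact: cvg_id.
exact: (@cvg_comp _ _ _ _ _ _ _ _ (@sd_homeo_continuous R _ x) (IH _)).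
Qed.

Lemma sd_inv_iter_continuous (N : scomplex) (k : nat) :
  continuous (@sd_inv_iter N k).
Proof.
elim: k => [|k IH] x; first exact: cvg_id.
exact: (@cvg_comp _ _ _ _ _ _ _ _ (IH x) (@sd_inv_continuous R _ _)).
Qed.

(** All vertices in the support of x are vertices of A, so restricting the coordinates to the
    subtype loses only zeros. The explicit coordinates serve to prove the lift continuous. *)
Lemma lift_subcomplex (K : scomplex) (A : subcomplex K) (x : realization R K) :
  vsupport (bcoord x) \in sub_simplices A ->
  exists y : realization R (complex_of_sub A),
    realize (smap_incl A) y = x /\ forall v, bcoord y v = bcoord x (val v).
Proof.
move=> xA.
have xval v : bcoord x v != 0 -> [set v]%SET \in sub_simplices A.
  move=> xv; apply: (sub_simplicesS xA).
    by rewrite finset.sub1set inE.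
  by apply/set0Pn; exists v; rewrite inE.
pose q : prod_topology (fun _ : complex_of_sub A => R) := fun v => bcoord x (val v).
have sum_q (P : pred K) : \sum_(v : complex_of_sub A | P (val v)) q v =
    \sum_(v | P v) bcoord x v.
  rewrite [RHS](bigID (fun v => [set v]%SET \in sub_simplices A)) /=.
  rewrite [X in _ = _ + X]big1 ?addr0; last first.
    by move=> v /andP[_]; apply: contraNeq; apply: xval.
  rewrite [RHS](reindex_omap (val : complex_of_sub A -> K) insub); last first.
    by move=> v /andP[_ vA]; rewrite insubT.
  by apply: eq_bigl => -[v vA] /=; rewrite insubT vA /= eqxx !andbT.
have qP : q \in @realization_set R (complex_of_sub A).
  apply/mem_set; split=> [v||].
  - exact: bcoord_ge0.
  - by rewrite (sum_q xpredT) bcoord_sum.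
  - rewrite inE; suff -> : (val @: vsupport q = vsupport (bcoord x))%SET by [].
    apply/setP => v; apply/finset.imsetP/idP => [[u] + ->|]; first by rewrite !inE.
    rewrite inE => xv.
    exists (exist (fun v => [set v]%SET \in sub_simplices A) v (xval v xv)) => //.
    by rewrite inE.
exists (exist (fun q => q \in @realization_set R (complex_of_sub A)) q qP).
split=> //; apply: realization_eq => v.
transitivity (\sum_(w | w == v) bcoord x w); last exact: big_pred1_eq.
exact: (sum_q (pred1 v)).
Qed.

End SimplicialMaps.

Section CoverToSections.
Variables (R : realType) (K : scomplex) (le : vertex_order K) (n : nat).
Variable appr : approx_sequence le n.
Hypothesis appr_id : forall k : nat,
  simplicial_approximation (@sd_homeo R (sd_iter k (oprod le n))) (appr k).

Local Notation rpow := (prod_topology (fun _ : 'I_n => realization R K)).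

Lemma iota_approximation k :
  simplicial_approximation (@sd_homeo_iter R (oprod le n) k) (iota_map appr k).
Proof.
elim: k => [|k IH]; first by move=> x s _; rewrite realize_id.
exact: simplicial_approximation_comp IH (@appr_id k).
Qed.

Lemma subcomplex_retraction (M : scomplex) (A : subcomplex M) (y : realization R (sd M)) :
  0 < \sum_(s : sd M | val s \in sub_simplices A) bcoord y s ->
  exists z : realization R (sd M), forall s, bcoord z s =
    if val s \in sub_simplices A then
      bcoord y s / \sum_(s : sd M | val s \in sub_simplices A) bcoord y s else 0.
Proof.
set w := \sum_(s | _) _ => w0.
pose q : prod_topology (fun _ : sd M => R) :=
  fun s => if val s \in sub_simplices A then bcoord y s / w else 0.
suff qP : q \in @realization_set R (sd M).
  by exists (exist (fun q => q \in @realization_set R (sd M)) q qP).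
have q1 : \sum_s q s = 1.
  by rewrite -big_mkcond -mulr_suml divff // gt_eqF.
apply/mem_set; split=> // [s|].
  by rewrite /q; case: ifP => // _; rewrite divr_ge0 ?bcoord_ge0 // ltW.
apply: (simplicesS (vsupport_simplex y)).
  apply/fintype.subsetP => s; rewrite !inE /q; case: ifP => _; last by rewrite eqxx.
  by apply: contraNneq => ->; rewrite mul0r.
exact: vsupport_neq0 q1.
Qed.

Lemma genus_cover_of_SC_cover k r : (1 < n)%N ->
  SC_cover appr k r -> genus_cover (@path_eval R n (realization R K)) r.
Proof.
move=> n1 [A [Acov Acont]].
pose M := sd_iter k (oprod le n).
(* One subdivision beyond level k: a chain of simplices that all belong to [A i] is a simplex of its
   subdivision, so dropping the other coordinates lands over [A i]. In M itself, vertices of [A i]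
   may span a simplex outside [A i]. *)
pose Y (z : rpow) : realization R (sd M) := sd_inv (sd_inv_iter k (oprod_inv le z)).
have cY : continuous Y.
  move=> z.
  have c1 := @cvg_comp _ _ _ _ _ _ _ _ (@oprod_inv_continuous R K le n z)
    (@sd_inv_iter_continuous R (oprod le n) k _).
  exact: (@cvg_comp _ _ _ _ _ _ _ _ c1 (@sd_inv_continuous R _ _)).
have YK z j : realize (oproj le j) (sd_homeo_iter (sd_homeo (Y z))) = z j.
  by rewrite /Y sd_invK sd_inv_iterK oprod_invK.
pose w i z := \sum_(s : sd M | val s \in sub_simplices (A i)) bcoord (Y z) s.
have cw i : continuous (w i).
  apply: sum_continuous => s z.
  exact: (@cvg_comp _ _ _ _ (fun y => bcoord y s) _ _ _ (cY z) (@bcoord_continuous R _ s _)).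
exists (fun i => [set z | 0 < w i z]); split=> [i||i].
- by have /continuousP /(_ _ (@open_gt R 0)) := cw i.
- apply/seteqP; split=> // z _.
  have [s sy _] := vsupport_sd_homeo (Y z).
  have [i si] := Acov _ (valP s); exists i => //=.
  rewrite /w (bigD1 s) //= ltr_pwDl //; first by rewrite -in_vsupport.
  by apply: sumr_ge0 => t _; apply: bcoord_ge0.
(* U is the open star of |sd (A i)| in |sd M|; dropping the coordinates outside
   A i retracts it, inside each simplex, onto |A i|. *)
set U := [set z | 0 < w i z].
have cval : continuous (fun b : U => \val b : rpow) by exact: set_val_continuous.
have cYb : continuous (fun b : U => Y (\val b)).
  by move=> b; exact: (@cvg_comp _ _ _ _ _ _ _ _ (cval b) (cY _)).
have /choice[rho rhoE] : forall b : U, exists z : realization R (sd M), forall s,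
    bcoord z s = if val s \in sub_simplices (A i) then
      bcoord (Y (\val b)) s / w i (\val b) else 0.
  by move=> b; apply: subcomplex_retraction; apply: (set_mem (valP b)).
have crho : continuous rho.
  apply: continuous_realization => s.
  rewrite (_ : (fun b => _) = (fun b => if val s \in sub_simplices (A i) then
      bcoord (Y (\val b)) s / w i (\val b) else 0)); last first.
    by apply/funext => b; apply: rhoE.
  case: (val s \in sub_simplices (A i)); last exact: cst_continuous.
  have c1 : continuous (fun b : U => bcoord (Y (\val b)) s).
    by move=> b; exact: (@cvg_comp _ _ _ (fun b : U => Y (\val b))
      (fun y => bcoord y s) _ _ _ (cYb b) (@bcoord_continuous R _ s _)).
  have c2 : continuous (fun b : U => w i (\val b)).
    by move=> b; exact: (@cvg_comp _ _ _ (fun b : U => \val b) (w i) _ _ _ (cval b) (@cw i _)).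
  apply: mulr_continuous => // b; apply: (@cvgV _ _ _ (nbhs_filter b)); last exact: c2.
  by apply: lt0r_neq0; apply: (set_mem (valP b)).
have rho_sub b s : s \in vsupport (bcoord (rho b)) ->
    val s \in sub_simplices (A i) /\ s \in vsupport (bcoord (Y (\val b))).
  rewrite in_vsupport rhoE; case: ifP => [sA h|]; last by rewrite ltxx.
  split=> //; rewrite in_vsupport lt_def bcoord_ge0 andbT.
  by apply: contraTneq h => ->; rewrite mul0r ltxx.
have Yrho : homotopic R (fun b : U => Y (\val b)) rho.
  apply: homotopic_simplex => // b.
  exists (vsupport (bcoord (Y (\val b)))); first exact: vsupport_simplex.
  rewrite finset.subUset subxx /=; apply/fintype.subsetP => s.
  by case/rho_sub.
have /choice[E EP] : forall b : U, exists y : realization R (complex_of_sub (A i)),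
    realize (smap_incl (A i)) y = sd_homeo (rho b) /\
    forall v, bcoord y v = bcoord (sd_homeo (rho b)) (val v).
  move=> b; apply: lift_subcomplex.
  (* The largest simplex of the flag of [rho b] belongs to [A i] and contains the support of the
     image in |M|. *)
  have [s /rho_sub[sA _] ss] := vsupport_sd_homeo (rho b).
  exact: sub_simplicesS sA ss (simplex_neq0 (vsupport_simplex _)).
have csd : continuous (fun b : U => sd_homeo (rho b)).
  by move=> b; exact: (@cvg_comp _ _ _ _ _ _ _ _ (crho b) (@sd_homeo_continuous R _ _)).
have cE : continuous E.
  apply: continuous_realization => v.
  rewrite (_ : (fun b => _) = (fun b => bcoord (sd_homeo (rho b)) (val v))); last first.
    by apply/funext => b; apply: (EP b).2.
  move=> b.
  exact: (@cvg_comp _ _ _ _ (fun y => bcoord y (val v)) _ _ _ (csd b) (@bcoord_continuous R _ _ _)).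
pose f j (b : U) := realize (smap_restrict (A i) (pi_map appr k j)) (E b).
have ccoord j : continuous (fun b : U => \val b j).
  move=> b; exact: (@cvg_comp _ _ _ (fun b : U => \val b) (fun z : rpow => z j) _ _ _
    (cval b) (@prod_coord_continuous _ _ j (\val b))).
have coord_f j : homotopic R (fun b : U => \val b j) (f j).
  pose h (y : realization R (sd M)) := realize (oproj le j) (sd_homeo_iter (sd_homeo y)).
  have cit : continuous (fun y : realization R M => realize (oproj le j) (sd_homeo_iter y)).
    move=> y; exact: (@cvg_comp _ _ _ _ _ _ _ _
      (@sd_homeo_iter_continuous R _ k y) (@realize_continuous R _ _ _ _)).
  have ch : continuous h.
    by move=> y; exact: (@cvg_comp _ _ _ _ _ _ _ _ (@sd_homeo_continuous R _ y) (cit _)).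
  (* Two moves starting from [\val b j], which is h of the lift of b: first the lift is retracted to
     [rho b], then the iterated homeomorphism is replaced by its approximation [iota_map]. *)
  have H1 := homotopic_compl ch Yrho.
  have H2 := simplicial_approximation_homotopic
    (@sd_homeo_iter_continuous R _ k) (@iota_approximation k).
  have H3 := homotopic_compl (@realize_continuous R _ _ (oproj le j)) (homotopic_compr csd H2).
  have EY : (fun b : U => \val b j) = h \o (fun b : U => Y (\val b)).
    by apply/funext => b; rewrite /= /h YK.
  have Ef : f j = realize (oproj le j) \o (realize (iota_map appr k) \o
      (fun b : U => sd_homeo (rho b))).
    by apply/funext => b; rewrite /f /= /smap_restrict !realize_comp (EP b).1.
  rewrite EY Ef; apply: homotopic_trans H1 (homotopic_sym H3).
  by rewrite -EY.
apply: section_of_homotopic => // j j'.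
apply: homotopic_trans (ccoord j) (coord_f j) _.
apply: homotopic_trans (homotopic_sym (coord_f j')).
  by move=> b; exact: (@cvg_comp _ _ _ _ _ _ _ _ (cE b) (@realize_continuous R _ _ _ _)).
have := @contiguous_homotopic R _ _ _ _ (Acont i j j').
exact: homotopic_compr.
Qed.

End CoverToSections.

(** * Mesh of iterated subdivisions *)

Section Mesh.
Variable R : realType.

(** F is affine on each simplex, with vertex values P oscillating by at most D there. The mesh is
    measured through such functions instead of a metric on |M|. *)
Definition affine_osc (M : scomplex) (F : realization R M -> R) (D : R) :=
  exists2 P : M -> R, (forall x, F x = \sum_u bcoord x u * P u) &
    forall s u v, s \in simplices M -> u \in s -> v \in s -> `|P u - P v| <= D.

Lemma convex_dist (M : scomplex) (x : realization R M) (P : M -> R) (a D : R) :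
  (forall u, u \in vsupport (bcoord x) -> `|P u - a| <= D) ->
  `|\sum_u bcoord x u * P u - a| <= D.
Proof.
move=> PD; rewrite -[X in _ - X]mul1r -(bcoord_sum x) mulr_suml -sumrB.
apply: le_trans (ler_norm_sum _ _ _) _.
rewrite -[leRHS]mul1r -(bcoord_sum x) mulr_suml; apply: ler_sum => u _.
rewrite -mulrBr normrM ger0_norm ?bcoord_ge0 //.
have [->|xu] := eqVneq (bcoord x u) 0; first by rewrite !mul0r.
by rewrite ler_wpM2l ?bcoord_ge0 // PD // inE.
Qed.

Lemma affine_osc_dist (M : scomplex) (F : realization R M -> R) (D : R) :
  affine_osc F D -> forall s x y, s \in simplices M ->
  vsupport (bcoord x) \subset s -> vsupport (bcoord y) \subset s ->
  `|F x - F y| <= D.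
Proof.
move=> [P FP PD] s x y sM /fintype.subsetP xs /fintype.subsetP ys.
rewrite !FP; apply: convex_dist => u /xs us.
rewrite distrC; apply: convex_dist => v /ys vs.
exact: PD sM vs us.
Qed.

Definition average (M : scomplex) (P : M -> R) (s : {set M}) : R :=
  (\sum_(u in s) P u) / #|s|%:R.

Lemma average_dist (M : scomplex) (P : M -> R) (s : {set M}) (a D : R) :
  s != finset.set0 -> \sum_(u in s) `|P u - a| <= #|s|%:R * D ->
  `|average P s - a| <= D.
Proof.
rewrite -card_gt0 -(ltr0n R) => s0 PD.
rewrite -(@ler_pM2l _ #|s|%:R) // -[X in X * `|_|]ger0_norm ?ler0n // -normrM.
rewrite mulrBr /average mulrC divfK ?gt_eqF // [_ * a]mulr_natl -sumr_const -sumrB.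
exact: le_trans (ler_norm_sum _ _ _) PD.
Qed.

(** The new vertex values are averages of P over simplices. For a face s of t and u in s, [P u]
    differs from the average over t by at most (1 - 1/#t) D; averaging over u in s keeps the
    bound. *)
Lemma affine_osc_sd (M : scomplex) (F : realization R M -> R) (D : R) (m : nat) :
  0 <= D -> (forall s, s \in simplices M -> (#|s| <= m)%N) ->
  affine_osc F D -> affine_osc (F \o @sd_homeo R M) ((1 - m%:R^-1) * D).
Proof.
move=> D0 cm [P FP PD]; exists (fun s : sd M => average P (val s)) => [y|].
  have yE u : bcoord (sd_homeo y) u * P u =
      \sum_(s : sd M | u \in val s) bcoord y s / #|val s|%:R * P u.
    by rewrite -mulr_suml.
  rewrite [LHS]FP (eq_bigr _ (fun u _ => yE u)).
  rewrite (exchange_big_dep xpredT) //=; apply: eq_bigr => s _.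
  by rewrite -mulr_sumr /average -mulrA [#|_|%:R^-1 * _]mulrC.
have osc (s t : sd M) : val s \subset val t ->
    `|average P (val s) - average P (val t)| <= (1 - m%:R^-1) * D.
  move=> /fintype.subsetP st; have s0 := simplex_neq0 (valP s).
  have t0 := simplex_neq0 (valP t).
  have tm : (1 - #|val t|%:R^-1) * D <= (1 - m%:R^-1) * D.
    apply: ler_wpM2r => //; rewrite lerB // lef_pV2 ?ler_nat ?cm ?(valP t) //.
      rewrite posrE ltr0n; apply: leq_trans (cm _ (valP t)).
      by rewrite card_gt0.
    by rewrite posrE ltr0n card_gt0.
  apply: average_dist => //; rewrite mulr_natl -sumr_const; apply: ler_sum => u us.
  rewrite distrC; apply: le_trans tm; apply: average_dist => //.
  have ut := st _ us.
  (* The term of u itself vanishes, leaving #t - 1 terms of size at most D. *)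
  rewrite (bigD1 u) //= subrr normr0 add0r mulrA mulrBr mulr1 divff; last first.
    by rewrite pnatr_eq0 cards_eq0.
  rewrite (cardsD1 u) ut add1n -natr1 addrK mulr_natl -sumr_const.
  rewrite [leRHS](eq_bigl (fun v => (v \in val t) && (v != u))); last first.
    by move=> v; rewrite !inE andbC.
  by apply: ler_sum => v /andP[vt _]; apply: PD (valP t) vt ut.
move=> c s t; rewrite inE => /andP[_ /'forall_implyP cc] sc tc.
have /'forall_implyP/(_ t tc)/orP[st|ts] := cc s sc; first exact: osc.
by rewrite distrC; apply: osc.
Qed.

(** The members of a chain have distinct cardinalities between 1 and m. Hence the contraction factor
    is the same at every subdivision. *)
Lemma sd_card (M : scomplex) (m : nat) :
  (forall s, s \in simplices M -> (#|s| <= m)%N) ->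
  forall c, c \in simplices (sd M) -> (#|c| <= m)%N.
Proof.
move=> cm c; rewrite inE => /andP[_ /'forall_implyP cc].
pose f (s : sd M) : 'I_m.+1 := inord #|val s|.
have fE s : f s = #|val s| :> nat by rewrite inordK // ltnS cm // (valP s).
have finj : {in c &, injective f}.
  move=> s t sc tc /(congr1 val) /=; rewrite !fE => st; apply: val_inj.
  have /'forall_implyP/(_ t tc)/orP[h|h] := cc s sc.
    by apply/eqP; rewrite eqEcard h st leqnn.
  by apply/eqP; rewrite eq_sym eqEcard h st leqnn.
rewrite -(card_in_imset finj).
apply: (@leq_trans #|[set~ (ord0 : 'I_m.+1)]%SET|); last by rewrite cardsC1 card_ord.
apply: subset_leq_card; apply/fintype.subsetP => _ /finset.imsetP[s sc ->].
rewrite !inE -val_eqE /= fE cards_eq0; exact: simplex_neq0 (valP s).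
Qed.

Lemma affine_osc_iter (N : scomplex) (F : realization R N -> R) (D : R) (m k : nat) :
  (0 < m)%N -> 0 <= D -> (forall s, s \in simplices N -> (#|s| <= m)%N) ->
  affine_osc F D ->
  affine_osc (F \o @sd_homeo_iter R N k) ((1 - m%:R^-1) ^+ k * D).
Proof.
move=> m0 D0 cm FD.
have r0 : 0 <= 1 - m%:R^-1 :> R.
  by rewrite subr_ge0 invf_le1 ?ltr0n // ler1n.
have cmk k' : forall s, s \in simplices (sd_iter k' N) -> (#|s| <= m)%N.
  by elim: k' => // k' IH; apply: sd_card.
elim: k => [|k IH]; first by rewrite expr0 mul1r.
rewrite exprS -mulrA; apply: (affine_osc_sd _ (cmk k) IH).
by rewrite mulr_ge0 // exprn_ge0.
Qed.

Lemma affine_osc_coord (N K : scomplex) (f : smap N K) (v : K) :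
  affine_osc (fun x : realization R N => bcoord (realize f x) v) 1.
Proof.
exists (fun u => (f u == v)%:R) => [x|s u w _ _ _].
  rewrite [LHS]big_mkcond /=; apply: eq_bigr => u _.
  by case: (f u == v); rewrite ?mulr1 ?mulr0.
by case: (f u == v); case: (f w == v);
  rewrite ?subrr ?subr0 ?sub0r ?normrN ?normr0 ?normr1 ?ler01.
Qed.

Lemma mesh_small (N : scomplex) (e : R) : 0 < e ->
  exists k, forall (K : scomplex) (f : smap N K) s (x y : realization R (sd_iter k N)) v,
    s \in simplices (sd_iter k N) ->
    vsupport (bcoord x) \subset s -> vsupport (bcoord y) \subset s ->
    `|bcoord (realize f (sd_homeo_iter x)) v - bcoord (realize f (sd_homeo_iter y)) v| < e.
Proof.
(* The successor keeps m positive when N is empty. *)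
move=> e0; pose m := #|N|.+1; pose q : R := 1 - m%:R^-1.
have [k ke] : exists k, q ^+ k < e.
  have q0 : 0 <= q by rewrite subr_ge0 invf_le1 ?ltr0n // ler1n.
  have q1 : `|q| < 1 by rewrite ger0_norm // ltrBlDr ltrDl invr_gt0 ltr0n.
  have /cvgrPdist_lt /(_ _ e0) [k _ /(_ k)] := cvg_expr q1.
  rewrite /= sub0r normrN leqnn => /(_ isT); rewrite ger0_norm ?exprn_ge0 // => ke.
  by exists k.
exists k => K f s x y v sN xs ys; apply: le_lt_trans ke.
have cm (t : {set N}) : t \in simplices N -> (#|t| <= m)%N.
  by move=> _; rewrite (leq_trans (max_card _)).
have := affine_osc_iter k (ltn0Sn _) ler01 cm (affine_osc_coord f v).
by rewrite mulr1 => /affine_osc_dist /(_ s x y sN xs ys).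
Qed.

End Mesh.

(** * Compactness *)

Section Compactness.
Variable R : realType.

Lemma compact_set_type (X : topologicalType) (A : set X) :
  compact A -> compact [set: A].
Proof.
move=> cA F PF _.
have FA : ((fun a : A => \val a) @ F) A.
  by apply: (@filterS _ F _ setT) => [a _|]; [exact: (set_mem (valP a)) | exact: filterT].
have [x [Ax clx]] := cA _ (fmap_proper_filter (fun a : A => \val a) PF) FA.
exists (exist (fun x => x \in A) x (mem_set Ax)); split=> // P Q FP.
move=> [_ [[V oV <-] /= Vx] VQ].
pose VP : set X := [set x | exists2 a : A, P a & \val a = x].
have FVP : ((fun a : A => \val a) @ F) VP.
  by apply: (@filterS _ F _ P) FP => a Pa; exists a.
have [y [[a Pa <-] Va]] := clx VP V FVP (open_nbhs_nbhs (conj oV Vx)).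
by exists a; split=> //; apply: VQ.
Qed.

Lemma realization_compact (K : scomplex) : compact [set: realization R K].
Proof.
apply: compact_set_type.
pose cube := [set x : prod_topology (fun _ : K => R) | forall v, `[0, 1]%classic (x v)].
have ccube : compact cube.
  by apply: (@tychonoff K (fun=> R) (fun=> `[0, 1]%classic)) => v; apply: segment_compact.
have coord v : continuous (fun x : prod_topology (fun _ : K => R) => x v).
  exact: (@prod_coord_continuous K (fun _ => R)).
apply: (subclosed_compact _ ccube).
  move=> x clx.
  have sum1 : \sum_v x v = 1.
    apply: contrapT => /eqP xs.
    have cs : continuous (fun x : prod_topology (fun _ : K => R) => \sum_v x v).
      exact: sum_continuous.
    have : nbhs x [set y : prod_topology (fun _ : K => R) | \sum_v y v != 1].
      exact: (cs x [set t | t != 1] (open_nbhs_nbhs (conj (@open_neq R 1) xs))).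
    by move=> /clx [y [[_ y1 _] /=]]; rewrite y1 eqxx.
  split=> // [v|].
    rewrite leNgt; apply/negP => xv.
    have : nbhs x [set y : prod_topology (fun _ : K => R) | y v < 0].
      exact: (coord v x [set t | t < 0] (open_nbhs_nbhs (conj (@open_lt R 0) xv))).
    by move=> /clx [y [[y0 _ _] /=]]; rewrite ltNge y0.
  (* Coordinates nonzero at x remain so nearby, so the support of x is a face of the support of some
     point of the realization. *)
  have : nbhs x [set y : prod_topology (fun _ : K => R) | forall v, x v != 0 -> y v != 0].
    apply: (@filter_forall _ _ (fun v (y : prod_topology (fun _ : K => R)) =>
       x v != 0 -> y v != 0) (nbhs x) (nbhs_filter x)) => v.
    have [xv|xv] := eqVneq (x v) 0; first by apply: filterE => y /=.
    have : nbhs x [set y : prod_topology (fun _ : K => R) | y v != 0].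
      exact: (coord v x [set t | t != 0] (open_nbhs_nbhs (conj (@open_neq R 0) xv))).
    exact: filterS.
  move=> /clx [y [[_ _ yK] xy]]; apply: (simplicesS yK).
    by apply/fintype.subsetP => v; rewrite !inE; apply: xy.
  exact: vsupport_neq0 sum1.
move=> x [x0 x1 _] v; rewrite /= in_itv /= x0 /= -x1 (bigD1 v) //= lerDl.
by apply: sumr_ge0.
Qed.

Lemma unit_interval_compact : compact [set: unit_interval R].
Proof. by apply: compact_set_type; apply: segment_compact. Qed.

Lemma unit_interval_hausdorff : hausdorff_space (unit_interval R).
Proof.
move=> p q pq; apply: val_inj; apply: (@Rhausdorff R) => A B Ap Bq.
have cval := @set_val_continuous R `[0, 1]%classic.
by have [t [At Bt]] := pq _ _ (cval p _ Ap) (cval q _ Bq); exists (\val t).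
Qed.

Lemma unit_interval_locally_compact : locally_compact [set: unit_interval R].
Proof.
move=> t _; exists setT; first exact: filterT.
by split; [apply: unit_interval_compact | apply: closedT].
Qed.

Section Power.
Variables (K : scomplex) (n : nat).
Local Notation rpow := (prod_topology (fun _ : 'I_n => realization R K)).

Lemma rpow_compact : compact [set: rpow].
Proof.
have := @tychonoff 'I_n (fun=> realization R K) (fun=> setT)
  (fun=> @realization_compact K).
by rewrite (_ : mkset _ = setT) //; apply/seteqP; split.
Qed.

Lemma realization_ballD (x y z : rpow) (d e : R) :
  realization_ball x d y -> realization_ball y e z -> realization_ball x (d + e) z.
Proof.
move=> xy yz j v; apply: le_lt_trans (ler_distD (bcoord (y j) v) _ _) _.
by rewrite ltrD.
Qed.

Lemma realization_ballC (x y : rpow) (d : R) :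
  realization_ball x d y -> realization_ball y d x.
Proof. by move=> xy j v; rewrite distrC. Qed.

Lemma realization_ballS (x y : rpow) (d e : R) : d <= e ->
  realization_ball x d y -> realization_ball x e y.
Proof. by move=> de xy j v; apply: lt_le_trans de. Qed.

(** If the e-ball of z lies in [U i], so does the e/2-ball of any point within e/2 of z;
    compactness, in near-covering form, then gives one radius for all points. *)
Lemma lebesgue_number (I : Type) (U : I -> set rpow) :
  (forall i, open (U i)) -> \bigcup_i U i = setT ->
  exists2 e, 0 < e & forall z, exists i, realization_ball z e `<=` U i.
Proof.
move=> oU cU.
have : \forall e \near 0^'+, [set: rpow] `<=` (fun z => exists i, realization_ball z e `<=` U i).
  have /compact_near_coveringP := rpow_compact; apply => z _.
  have [i _ Uz] : (\bigcup_i U i) z by rewrite cU.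
  have [e e0 eU] := realization_ball_sub (open_nbhs_nbhs (conj (oU i) Uz)).
  have e20 : 0 < e / 2 by rewrite divr_gt0.
  exists (realization_ball z (e / 2), [set d | d < e / 2]) => /=.
    by split; [apply: nbhs_realization_ball | apply: nbhs_right_lt].
  move=> [z' d] /= [zz' de]; exists i => y z'y; apply: eU.
  apply: realization_ballS (realization_ballD zz' z'y).
  by rewrite [leRHS](splitr e) lerD2l ltW.
move=> H.
have [e [e0 eU]] := filter_ex (filterI (nbhs_right_gt (0 : R)) H).
by exists e => // z; apply: eU.
Qed.

End Power.

End Compactness.

(** * From motion planners to contiguity *)

Section SectionsToCover.
Variables (R : realType) (K : scomplex) (n : nat).
Local Notation rpow := (prod_topology (fun _ : 'I_n => realization R K)).

Definition path_at (X : topologicalType) (alpha : path_space R X)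
    (t : unit_interval R) : X := (alpha : continuousType (unit_interval R) X) t.

(** Uncurrying for the compact-open topology, using that the unit interval is locally compact and
    Hausdorff. *)
Lemma section_joint_continuous (U : set rpow) (s : U -> path_space R (realization R K)) :
  continuous s ->
  continuous (fun p : U * unit_interval R => path_at (s p.1) p.2).
Proof.
move=> cs.
pose F (b : U) : {compact-open, unit_interval R -> realization R K} :=
  (s b : continuousType (unit_interval R) (realization R K)).
have cF : continuous F.
  move=> b; exact: (@cvg_comp _ _ _ s _ _ _ _ (cs b) (@initial_continuous _ _ _ (s b))).
have cu : continuous (uncurry F : U * unit_interval R -> realization R K).
  apply: continuous_uncurry cF _; first exact: unit_interval_locally_compact.
    exact: unit_interval_hausdorff.
  move=> b; exact: (@cts_fun _ _ (s b : continuousType (unit_interval R) (realization R K))).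
by rewrite (_ : (fun p => _) = uncurry F) //; apply/funext => -[].
Qed.

Lemma nbhs_joint_ball (U : set rpow) (b : U) (t : unit_interval R)
    (W : set (U * unit_interval R)) : nbhs (b, t) W ->
  exists2 e, 0 < e & forall b' t', realization_ball (\val b) e (\val b') ->
    `|\val t - \val t'| < e -> W (b', t').
Proof.
move=> [[P Q] /= [[_ [[P' oP' <-] /= P'b] PP] [_ [[Q' oQ' <-] /= Q't] QQ]] PQW].
have [e1 e10 e1P] := realization_ball_sub (open_nbhs_nbhs (conj oP' P'b)).
have /nbhs_ballP[e2 /= e20 e2Q] := open_nbhs_nbhs (conj oQ' Q't).
exists (Num.min e1 e2); first by rewrite lt_min e10.
move=> b' t' bb' tt'; apply: PQW; split => /=.
  by apply/PP/e1P; apply: realization_ballS bb'; rewrite ge_min lexx.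
by apply/QQ/e2Q; apply: lt_le_trans tt' _; rewrite ge_min lexx orbT.
Qed.

(** U need not be compact, so d is uniform only over the points b whose eta-ball stays in U. *)
Lemma section_uniform (U : set rpow) (s : U -> path_space R (realization R K))
    (eta e : R) : continuous s -> 0 < eta -> 0 < e ->
  exists2 d, 0 < d & forall (b b' : U) (t t' : unit_interval R),
    realization_ball (\val b) eta `<=` U ->
    realization_ball (\val b) d (\val b') -> `|\val t - \val t'| < d ->
    forall w,
    `|bcoord (path_at (s b) t) w - bcoord (path_at (s b') t') w| < e.
Proof.
move=> cs eta0 e0.
pose H (b : U) (t : unit_interval R) := path_at (s b) t.
(* The property concerns ambient points, with their lifts to U quantified inside, because it is the
   whole product that is compact. *)
pose P d (zt : rpow * unit_interval R) := forall (b b' : U) (t' : unit_interval R),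
  \val b = zt.1 ->
  realization_ball zt.1 eta `<=` U -> realization_ball zt.1 d (\val b') ->
  `|\val zt.2 - \val t'| < d ->
  forall w, `|bcoord (H b zt.2) w - bcoord (H b' t') w| < e.
suff : \forall d \near 0^'+, [set: rpow] `*` [set: unit_interval R] `<=` P d.
  move=> PP; have [d [d0 dP]] := filter_ex (filterI (nbhs_right_gt (0 : R)) PP).
  exists d => // b b' t t' bU bb' tt' w.
  exact: (dP (\val b, t) (conj I I) b b' t' erefl bU bb' tt' w).
have /compact_near_coveringP :=
  compact_setX (@rpow_compact R K n) (@unit_interval_compact R).
apply => -[z t] _.
(* If z is outside U, a point within eta of z has an eta-ball containing z, hence not inside U: the
   property is vacuous near z. *)
have [Uz|nUz] := pselect (U z); last first.
  exists ([set zt | realization_ball z eta zt.1], setT) => /=.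
    split; last exact: filterT.
    exists (realization_ball z eta, setT) => /=; last by move=> ? [].
    by split; [apply: nbhs_realization_ball | apply: filterT].
  move=> [[z' t'] d] /= [zz' _] b b' t'' _ /(_ z) /= z'U.
  by case: nUz; apply: z'U; apply: realization_ballC.
pose b0 : U := exist (fun z => z \in U) z (mem_set Uz).
have : nbhs (b0, t) [set p : U * unit_interval R | forall w,
    `|bcoord (H b0 t) w - bcoord (H p.1 p.2) w| < e / 2].
  apply: (@filter_forall _ _ (fun w (p : U * unit_interval R) =>
    `|bcoord (H b0 t) w - bcoord (H p.1 p.2) w| < e / 2)
    (nbhs (b0, t)) (nbhs_filter _)) => w.
  have cH : continuous (fun p : U * unit_interval R => bcoord (H p.1 p.2) w).
    have cc : continuous ((fun x => bcoord x w) \o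
        (fun p : U * unit_interval R => path_at (s p.1) p.2)).
      move=> p; apply: continuous_comp; first exact: section_joint_continuous.
      exact: bcoord_continuous.
    exact: cc.
  by have /cvgrPdist_lt := cH (b0, t); apply; rewrite divr_gt0.
move=> /nbhs_joint_ball[c c0 cP].
(* With half radii, both points to be compared are within c of the centre, and each costs at most e
   / 2. *)
have c20 : 0 < c / 2 by rewrite divr_gt0.
exists ([set zt | realization_ball z (c / 2) zt.1 /\ `|\val t - \val zt.2| < c / 2],
  [set d | d < c / 2]) => /=.
  split; last exact: nbhs_right_lt.
  exists (realization_ball z (c / 2), [set t' | `|\val t - \val t'| < c / 2]) => /=.
    split; first exact: nbhs_realization_ball.
    have ct : \val t' @[t' --> t] --> (\val t : R).
      exact: (@set_val_continuous R `[0, 1]%classic t).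
    by have /cvgrPdist_lt := ct; apply.
  by move=> [? ?] [].
move=> [[z' t'] d] /= [[zz' tt'] dc] b b' t'' bz' _ z'b' t't'' w.
have Hb : `|bcoord (H b0 t) w - bcoord (H b t') w| < e / 2.
  apply: (cP b t') => /=; last by apply: lt_le_trans tt' _; lra.
  by rewrite bz'; apply: realization_ballS zz'; lra.
have Hb' : `|bcoord (H b0 t) w - bcoord (H b' t'') w| < e / 2.
  apply: (cP b' t'') => /=.
    by apply: realization_ballS (realization_ballD zz' z'b'); lra.
  by apply: le_lt_trans (ler_distD (\val t') _ _) _; lra.
apply: le_lt_trans (ler_distD (bcoord (H b0 t) w) _ _) _.
by rewrite distrC; lra.
Qed.

End SectionsToCover.

Section SectionsToContiguity.
Variables (R : realType) (K : scomplex) (le : vertex_order K) (n : nat).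
Variable appr : approx_sequence le n.
Hypothesis appr_id : forall k : nat,
  simplicial_approximation (@sd_homeo R (sd_iter k (oprod le n))) (appr k).

Local Notation rpow := (prod_topology (fun _ : 'I_n => realization R K)).
Local Notation N := (oprod le n).

Lemma exists_barycenter (M : scomplex) (s : {set M}) : s \in simplices M ->
  exists x : realization R M, vsupport (bcoord x) = s.
Proof.
move=> sM; have s0 := simplex_neq0 sM.
pose q : prod_topology (fun _ : M => R) := fun v => if v \in s then #|s|%:R^-1 else 0.
have c0 : (#|s|%:R : R) != 0 by rewrite pnatr_eq0 cards_eq0.
have qs : vsupport q = s.
  apply/setP => v; rewrite inE /q; case: ifP => _; last by rewrite eqxx.
  by rewrite invr_eq0 c0.
have qP : q \in @realization_set R M.
  apply/mem_set; split=> [v||]; last by rewrite qs.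
    by rewrite /q; case: ifP => // _; rewrite invr_ge0.
  by rewrite -big_mkcond /= sumr_const -[LHS]mulr_natl divff.
by exists (exist (fun q => q \in @realization_set R M) q qP).
Qed.

(** Otherwise the coordinates would sum to at most #K / (#K + 1) < 1. *)
Lemma exists_large_coord (x : realization R K) :
  exists w, #|K|.+1%:R^-1 < bcoord x w.
Proof.
apply: contrapT => /forallNP small.
have : \sum_w bcoord x w <= #|K|%:R * #|K|.+1%:R^-1.
  rewrite mulr_natl -sumr_const; apply: ler_sum => w _.
  by rewrite leNgt; apply/negP.
apply/negP; rewrite bcoord_sum -ltNge ltr_pdivrMr ?ltr0n // mul1r ltr_nat.
exact: ltnSn.
Qed.

Definition power_map k (x : realization R (sd_iter k N)) : rpow :=
  fun j => realize (oproj le j) (sd_homeo_iter x).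

Lemma pi_map_support k (x : realization R (sd_iter k N)) j :
  (pi_map appr k j @: vsupport (bcoord x))%SET \subset
  vsupport (bcoord (power_map x j)).
Proof.
rewrite -vsupport_realize realize_comp !(vsupport_realize (oproj le j)).
apply: finset.imsetS; apply: (iota_approximation appr_id) => //.
exact: vsupport_simplex.
Qed.

Lemma segment_subdivision (a b d : R) : 0 <= a <= 1 -> 0 <= b <= 1 -> 0 < d ->
  exists (T : nat) (t : nat -> unit_interval R),
    [/\ \val (t 0%N) = a, \val (t T) = b &
      forall l, (l < T)%N -> `|\val (t l) - \val (t l.+1)| < d].
Proof.
move=> a01 b01 d0.
have [T _ /(_ T (leqnn T)) /= Td] := near_infty_natSinv_lt (PosNum d0).
pose T1 := T.+1.
(* Here a may exceed b, so the steps are signed; their size is at most 1 / T1 < d because a and b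
   lie in [0, 1]. Indices beyond T1 receive the dummy value a. *)
pose f (l : nat) : R := a + (l%:R / T1%:R) * (b - a).
have /choice[t tP] : forall l, exists t : unit_interval R, (l <= T1)%N -> \val t = f l.
  move=> l; have [lT|lT] := leqP l T1; last first.
    by exists (exist (fun t => t \in `[0, 1]%classic) a (mem_set a01)).
  have fP : f l \in (`[0, 1]%classic : set R).
    have c0 : 0 <= l%:R / T1%:R :> R by rewrite divr_ge0.
    have c1 : l%:R / T1%:R <= 1 :> R by rewrite ler_pdivrMr ?ltr0n // mul1r ler_nat.
    apply/mem_set; rewrite /= in_itv /= /f.
    by move/andP: a01 => [a0 a1]; move/andP: b01 => [b0 b1]; apply/andP; split; nra.
  by exists (exist (fun t => t \in `[0, 1]%classic) (f l) fP).
exists T1, t; split=> [||l lT].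
- by rewrite tP // /f mul0r mul0r addr0.
- by rewrite tP // /f divff ?pnatr_eq0 // mul1r addrC subrK.
- rewrite !tP ?(ltnW lT) // /f -natr1.
  have -> : a + l%:R / T1%:R * (b - a) - (a + (l%:R + 1) / T1%:R * (b - a)) =
    T1%:R^-1 * (a - b) by ring.
  rewrite normrM ger0_norm // (le_lt_trans _ Td) // ler_piMr //.
  move/andP: a01 => [a0 a1]; move/andP: b01 => [b0 b1].
  by rewrite ler_norml; apply/andP; split; lra.
Qed.

Lemma SC_cover_of_genus_cover r :
  genus_cover (@path_eval R n (realization R K)) r -> exists k, SC_cover appr k r.
Proof.
case=> U [oU cU sec].
pose s i := projT1 (cid (sec i)).
have cs i : continuous (s i) by have [] := projT2 (cid (sec i)).
have sE i (b : U i) j : path_at (s i b) (grid_point R j) = \val b j.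
  by have [_ /(_ b) <-] := projT2 (cid (sec i)).
have [eta eta0 etaP] := lebesgue_number oU cU.
have eta20 : 0 < eta / 2 by rewrite divr_gt0.
have e0 : 0 < (#|K|.+1%:R^-1 : R) by rewrite invr_gt0 ltr0n.
(* The tolerance equals the threshold of [exists_large_coord]: a coordinate above it at one point
   remains positive at every point close enough. *)
have /choice[dd ddP] : forall i, exists d, 0 < d /\ forall (b b' : U i) t t',
    realization_ball (\val b) (eta / 2) `<=` U i ->
    realization_ball (\val b) d (\val b') -> `|\val t - \val t'| < d ->
    forall w, `|bcoord (path_at (s i b) t) w - bcoord (path_at (s i b') t') w|
      < #|K|.+1%:R^-1.
  by move=> i; have [d d0 dP] := section_uniform (cs i) eta20 e0; exists d.
(* The default value 1 keeps d positive when r = 0. *)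
pose d := \big[Num.min/1]_i dd i.
have d0 : 0 < d by apply/bigmin_gtP; split=> // i _; have [] := ddP i.
have ddd i : d <= dd i by apply: bigmin_le.
(* The bound d serves uniform continuity inside a simplex; eta / 2 serves the covering property. *)
have [|k mesh] := @mesh_small R N (Num.min d (eta / 2)).
  by rewrite lt_min d0.
exists k; pose M := sd_iter k N.
have mesh_ball sg (x y : realization R M) : sg \in simplices M ->
    vsupport (bcoord x) \subset sg -> vsupport (bcoord y) \subset sg ->
    realization_ball (power_map x) (Num.min d (eta / 2)) (power_map y).
  by move=> sgM xs ys j v; apply: mesh sgM xs ys.
pose deep i (x : realization R M) := realization_ball (power_map x) (eta / 2) `<=` U i.
pose simp i : {set {set M}} := [set sg in simplices M |
  `[< forall x : realization R M, vsupport (bcoord x) \subset sg -> deep i x >]]%SET.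
have simpW i : simp i \subset simplices M.
  by apply/fintype.subsetP => sg; rewrite inE => /andP[].
have simpS i (sg tau : {set M}) : sg \in simp i -> tau \subset sg ->
    tau != finset.set0 -> tau \in simp i.
  rewrite !inE => /andP[sgM /asboolP sgi] ts t0; rewrite (simplicesS sgM) //=.
  by apply/asboolP => x xt; apply: sgi; apply: fintype.subset_trans ts.
exists (fun i => Subcomplex (simpW i) (@simpS i)); split=> [sg sgM|i j1 j2].
  (* The eta-ball of the barycenter lies in some [U i], and every point of the simplex is within eta
     / 2 of it, hence deep in [U i]. *)
  have [x0 x0s] := exists_barycenter sgM.
  have [i iP] := etaP (power_map x0); exists i; rewrite inE sgM /=.
  apply/asboolP => x xs y xy; apply: iP; rewrite [eta](splitr eta).
  apply: realization_ballD xy.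
  apply: realization_ballS (mesh_ball sg _ _ sgM _ xs); last by rewrite x0s.
  by rewrite ge_min lexx orbT.
set L := complex_of_sub _.
have lift (sg : {set M}) : sg \in simp i -> exists (x : realization R M) (b : U i),
    [/\ vsupport (bcoord x) = sg, \val b = power_map x & deep i x].
  rewrite inE => /andP[sgM /asboolP sgi].
  have [x xs] := exists_barycenter sgM; have xd : deep i x by apply: sgi; rewrite xs.
  have xU : power_map x \in U i.
    by apply/mem_set/xd => j v; rewrite subrr normr0.
  by exists x, (exist (fun z => z \in U i) (power_map x) xU).
have /choice[pt ptP] : forall v : L, exists b : U i, exists x : realization R M,
    [/\ vsupport (bcoord x) = [set val v]%SET, \val b = power_map x & deep i x].
  by move=> v; have [x [b xb]] := lift _ (valP v); exists b, x.
have unit01 (j : 'I_n) : 0 <= (\val (grid_point R j) : R) <= 1.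
  by have := set_mem (valP (grid_point R j)); rewrite /= in_itv.
have [T [t [t0 tT tl]]] := segment_subdivision (unit01 j1) (unit01 j2) d0.
have {}t0 : t 0%N = grid_point R j1 by apply: val_inj.
have {}tT : t T = grid_point R j2 by apply: val_inj.
have /choice[phi phiP] : forall lv : nat * L, exists w,
    #|K|.+1%:R^-1 < bcoord (path_at (s i (pt lv.2)) (t lv.1)) w.
  by move=> lv; apply: exists_large_coord.
(* A vertex map simultaneously approximating the motion planner at all times close
   to t l: this makes consecutive maps contiguous. *)
have phi_supp (sg : {set L}) : sg \in simplices L -> exists b : U i,
    (forall l l', `|\val (t l) - \val (t l')| < d ->
      ((fun v => phi (l, v)) @: sg)%SET \subset
        vsupport (bcoord (path_at (s i b) (t l')))) /\
    (forall j, (smap_restrict (Subcomplex (simpW i) (@simpS i)) (pi_map appr k j) @: sg)%SET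
        \subset vsupport (bcoord (path_at (s i b) (grid_point R j)))).
  move=> sgL; have /[dup] sgA : (val @: sg)%SET \in simp i by move: sgL; rewrite inE.
  move=> /lift[x [b [xs bx xd]]]; exists b; split=> [l l' ll'|j].
    apply/fintype.subsetP => _ /finset.imsetP[v vsg ->]; rewrite in_vsupport.
    have [y [ys by_ yd]] := ptP v.
    have [_ /(_ (pt v) b (t l) (t l'))] := ddP i.
    rewrite by_ => /(_ yd) H.
    have : realization_ball (power_map y) (dd i) (\val b).
      rewrite bx; apply: realization_ballS (mesh_ball _ _ _ (fintype.subsetP (simpW i) _ sgA) _ _).
      - by apply: le_trans (ddd i); rewrite ge_min lexx.
      - by rewrite ys finset.sub1set; apply: imset_f.
      - by rewrite xs.
    have h1 : #|K|.+1%:R^-1 < bcoord (path_at (s i (pt v)) (t l)) (phi (l, v)).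
      exact: phiP (l, v).
    move=> /H /(_ (lt_le_trans ll' (ddd i)) (phi (l, v))).
    (* The coordinate [phi (l, v)] exceeds the threshold at the vertex and changes by less than it,
       so it is positive at the barycenter. *)
    rewrite ltr_norml => /andP[_ h2]; move: h1 h2.
    set c := #|K|.+1%:R^-1; set x1 := bcoord _ _; set x2 := bcoord _ _.
    by move=> h1 h2; lra.
  rewrite sE bx; apply: fintype.subset_trans (pi_map_support _ _).
  by rewrite xs -finset.imset_comp.
have phi_simp l (sg : {set L}) : sg \in simplices L ->
    ((fun v => phi (l, v)) @: sg)%SET \in simplices K.
  move=> sgL; have [b [/(_ l l) bl _]] := phi_supp sg sgL.
  apply: simplicesS (vsupport_simplex _) (bl _) _; first by rewrite subrr normr0.
  by rewrite imset_eq0; apply: simplex_neq0.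
pose Phi l : smap L K := SMap (@phi_simp l).
pose f j := smap_restrict (Subcomplex (simpW i) (@simpS i)) (pi_map appr k j).
(* The T + 1 maps [Phi 0], ..., [Phi T] between the two projections make T + 2 contiguities. *)
exists T.+2, (fun m => if m is m'.+1 then (if (m' <= T)%N then Phi m' else f j2) else f j1).
split=> //; first by rewrite ltnn.
have union_simplex (sg : {set L}) (g h : smap L K) (z : realization R K) :
    sg \in simplices L ->
    (g @: sg)%SET \subset vsupport (bcoord z) ->
    (h @: sg)%SET \subset vsupport (bcoord z) ->
    (g @: sg :|: h @: sg)%SET \in simplices K.
  move=> sgL gz hz; apply: simplicesS (vsupport_simplex z) _ _.
    by rewrite finset.subUset gz.
  have /set0Pn[v vsg] := simplex_neq0 sgL.
  by apply/set0Pn; exists (g v); rewrite finset.in_setU imset_f.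
move=> m; rewrite ltnS => mT sg sgL; have [b [bl bj]] := phi_supp sg sgL.
have dd0 l : `|\val (t l) - \val (t l)| < d by rewrite subrr normr0.
(* At either end the common simplex is the support of the planner at [t 0] or [t T], the grid times
   of j1 and j2, where it also contains the image of the projection. *)
case: m mT => [_|m]; first by apply: union_simplex (bj j1) _ => //; rewrite -t0; apply: bl.
rewrite ltnS => mT; rewrite mT; case: ifP => [mT'|mT'].
  by apply: (union_simplex _ _ _ (path_at (s i b) (t m.+1))) => //; apply: bl => //; apply: tl.
have -> : m = T by apply/eqP; rewrite eqn_leq mT leqNgt mT'.
by apply: union_simplex _ (bj j2) => //; rewrite -tT; apply: bl.
Qed.

End SectionsToContiguity.

(** * Comparison of minima and conclusion *)

Lemma leastP (P : nat -> Prop) r :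
  least P = Some r <-> P r /\ forall m, P m -> (r <= m)%N.
Proof.
rewrite /least; case: pselect => [exP|nP]; last first.
  by split=> // -[Pr _]; case: nP; exists r; apply/asboolP.
case: ex_minnP => m /asboolP Pm mP; split=> [[<-]|[Pr rP]].
  by split=> // q Pq; apply/mP/asboolP.
by congr Some; apply/eqP; rewrite eqn_leq rP // andbT; apply/mP/asboolP.
Qed.

Lemma least_exists (P : nat -> Prop) m :
  P m -> exists2 r, least P = Some r & (r <= m)%N.
Proof.
move=> Pm; have : exists r, least P = Some r.
  by rewrite /least; case: pselect => [exP|[]]; [eexists | exists m; apply/asboolP].
by move=> [r] /[dup] lr /leastP[_ rP]; exists r; last exact: rP.
Qed.

(** Mutual domination is the right comparison here: [SC] ranges only over the minima attained at
    each level k, while the genus ranges over all sizes of covers. *)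
Lemma eq_least (P Q : nat -> Prop) :
  (forall r, P r -> exists2 m, Q m & (m <= r)%N) ->
  (forall r, Q r -> exists2 m, P m & (m <= r)%N) -> least P = least Q.
Proof.
move=> PQ QP.
have half (A B : nat -> Prop) :
    (forall r, A r -> exists2 m, B m & (m <= r)%N) ->
    (forall r, B r -> exists2 m, A m & (m <= r)%N) ->
    forall r, least A = Some r -> least B = Some r.
  move=> AB BA r /leastP[Ar rA].
  have rB m : B m -> (r <= m)%N.
    by move=> /BA[q /rA rq qm]; apply: leq_trans rq qm.
  apply/leastP; split=> //; have [m Bm mr] := AB r Ar.
  by have -> : r = m by apply/eqP; rewrite eqn_leq rB.
case lP : (least P) => [r|]; first by rewrite (half _ _ PQ QP _ lP).
by case lQ : (least Q) => [r|//]; rewrite -lP (half _ _ QP PQ _ lQ).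
Qed.

Theorem theoremA (R : realType) (K : scomplex) (le : vertex_order K) (n : nat)
    (appr : approx_sequence le n)
    (appr_id : forall k : nat,
       simplicial_approximation (@sd_homeo R (sd_iter k (oprod le n))) (appr k))
    (n_ge2 : (2 <= n)%N) :
  SC appr = TC R n (realization R K).
Proof.
apply: eq_least => r.
  move=> [k /leastP[cov _]]; exists r => //.
  exact: (genus_cover_of_SC_cover appr_id n_ge2 cov).
(* The cover of size r need not be minimal at level k; the minimum m there is at most r. *)
move=> /(SC_cover_of_genus_cover appr_id)[k /least_exists[m km mr]].
by exists m => //; exists k.
Qed.
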